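(* Let $\mathcal{H}$ be a real separable Hilbert space, let $C$ be a nonempty closed convex subset of $\mathcal{H}$, and let $f,g\in\Gamma_0(\mathcal{H})$, where $g$ is differentiable on $\mathcal{H}$ with a $\beta$-Lipschitz continuous gradient for some $\beta\in\,]0,+\infty[$. Suppose that the problem of minimizing $f+g$ over $C$ has a solution and that one of the following holds: (1) $C\cap\operatorname{int}\operatorname{dom}f\neq\varnothing$; (2) $\operatorname{dom}f\cap\operatorname{int}C\neq\varnothing$; (3) $\mathcal{H}$ is finite dimensional and $\operatorname{rint}C\cap\operatorname{rint}\operatorname{dom}f\neq\varnothing$. Let $(z_m)_{m\in\mathbb{N}}$, $(z_{m+\frac12})_{m\in\mathbb{N}}$ and $(x_{m,n})_{m\in\mathbb{N},\,0\le n\le N_m}$ be generated by the nested algorithm described in the context (Douglas-Rachford iterations with inner forward-backward iterations), with parameters $\kappa,\underline{\gamma},\underline{\lambda},(\tau_m),(\gamma_{m,n}),(\lambda_{m,n}),(N_m)$ as specified there. Then: (i) Let $\xi>0$ and $\rho=1-\dfrac{\underline{\lambda}\,\underline{\gamma}}{1+\underline{\gamma}}$. If $\inf g(C)>-\infty$ and, for every $m\in\mathbb{N}$, the positive integer $N_m$ is chosen such that $$\rho^{N_m}\sqrt{2\kappa}\,\big(g(z_0)-\inf g(C)\big)^{1/2}\le\xi\quad\text{if }m=0,$$ $$\rho^{N_m-1}\big(1+\xi^{-1}\rho^{1-m}\|z_m-z_{m-1}\|\big)\le1\quad\text{if }m>0,$$ then $(z_m)_{m\in\mathbb{N}}$ converges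 weakly to some $z\in\mathcal{H}$ such that $\operatorname{prox}_{\iota_C+\kappa g}z$ is a solution to the problem of minimizing $f+g$ over $C$. (ii) For every $m\in\mathbb{N}$, $(x_{m,n})_{0\le n\le N_m}$ (and thus $z_{m+\frac12}$) lies in $C$.
   Context: $\Gamma_0(\mathcal{H})$ denotes the class of lower semicontinuous convex functions from $\mathcal{H}$ to $]-\infty,+\infty]$ that are proper (not identically $+\infty$). $\operatorname{dom}f=\{x\mid f(x)<+\infty\}$; $\operatorname{int}S$ and $\operatorname{rint}S$ are the interior and relative interior of $S$. $\iota_C$ is the indicator function of $C$ ($0$ on $C$, $+\infty$ elsewhere), $P_C$ is the projection onto $C$, and for $h\in\Gamma_0(\mathcal{H})$, $\operatorname{prox}_h x=\arg\min_{y\in\mathcal{H}}\frac12\|y-x\|^2+h(y)$. Algorithm. Parameters: $\kappa\in\,]0,+\infty[$, $\underline{\gamma}\in\,]0,2\kappa^{-1}\beta^{-1}[$, $\underline{\lambda}\in\,]0,1]$, and a sequence $(\tau_m)_{m\in\mathbb{N}}$ with $\tau_m\in\,]0,2[$ for every $m$ and $\sum_{m\in\mathbb{N}}\tau_m(2-\tau_m)=+\infty$. Initialization: $z_0=z_{-1/2}\in C$. For $m=0,1,2,\ldots$: - set $x_{m,0}=z_{m-\frac12}$; - with an integer $N_m\ge1$, for $n=0,\ldots,N_m-1$, choose $\gamma_{m,n}\in[\underline{\gamma},2\kappa^{-1}\beta^{-1}[$ and $\lambda_{m,n}\in[\underline{\lambda},1]$ and set $$x_{m,n+1}=x_{m,n}+\lambda_{m,n}\left(P_C\Big(\frac{x_{m,n}-\gamma_{m,n}(\kappa\nabla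 g(x_{m,n})-z_m)}{1+\gamma_{m,n}}\Big)-x_{m,n}\right);$$ - set $z_{m+\frac12}=x_{m,N_m}$; - set $z_{m+1}=z_m+\tau_m\big(\operatorname{prox}_{\kappa f}(2z_{m+\frac12}-z_m)-z_{m+\frac12}\big)$. *)

(* Defs.v *)
From HB Require Import structures.
From mathcomp Require Import all_boot all_order all_algebra.
From mathcomp Require Import sesquilinear.
From mathcomp Require Import all_classical all_reals all_analysis.

Set Implicit Arguments.
Unset Strict Implicit.
Unset Printing Implicit Defensive.

Import Order.TTheory GRing.Theory Num.Theory.
Import numFieldNormedType.Exports.

Local Open Scope classical_set_scope.
Local Open Scope ring_scope.

(* A real Hilbert space is a complete normed module whose norm is induced by
   an inner product: [dot : {dot H for idfun}] is a symmetric, positive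
   definite bilinear form, and [hilbert_norm dot] ties it to the norm. *)
Definition hilbert_norm (R : realType) (H : normedModType R)
    (dot : {dot H for idfun}) : Prop :=
  forall x : H, `|x| ^+ 2 = dot x x.

Definition separable_space (T : topologicalType) : Prop :=
  exists2 D : set T, countable D & dense D.

Definition finite_dimensional (R : realType) (H : lmodType R) : Prop :=
  exists (n : nat) (e : 'I_n -> H),
    forall x : H, exists c : 'I_n -> R, x = \sum_(i < n) c i *: e i.

(* Weak convergence, tested against the functionals [dot ^~ y]; by Riesz these
   are all the continuous linear functionals. *)
Definition weakly_cvg_to (R : realType) (H : normedModType R)
    (dot : {dot H for idfun}) (u : nat -> H) (l : H) : Prop :=
  forall y : H, dot (u m) y @[m --> \oo] --> dot l y.

(* [gradient dot g x] is the Riesz representative of the Frechet differential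
   of [g] at [x]. *)
Definition gradient (R : realType) (H : normedModType R)
    (dot : {dot H for idfun}) (g : H -> R) (x : H) : H :=
  xget 0 [set v : H | forall h : H, 'd g x h = dot v h].

Definition edom (R : realType) (H : Type) (f : H -> \bar R) : set H :=
  [set x | (f x < +oo)%E].

Definition convex_efun (R : realType) (H : lmodType R) (f : H -> \bar R) : Prop :=
  forall (x y : H) (t : R), 0 < t < 1 ->
    (f (t *: x + (1 - t) *: y)%R <= t%:E * f x + (1 - t)%:E * f y)%E.

Definition Gamma0 (R : realType) (H : normedModType R) (f : H -> \bar R) : Prop :=
  [/\ forall x, (-oo < f x)%E, edom f !=set0, convex_efun f
    & lower_semicontinuous f].

Definition eindicator (R : realType) (H : Type) (C : set H) (x : H) : \bar R :=
  if x \in C then 0%E else +oo%E.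

Definition argmin (R : realType) (H : Type) (C : set H) (phi : H -> \bar R) : set H :=
  [set p | C p /\ forall y, C y -> (phi p <= phi y)%E].

Definition prox (R : realType) (H : normedModType R) (h : H -> \bar R) (x : H) : H :=
  xget 0 (argmin setT (fun y => ((2^-1 * `|y - x| ^+ 2)%:E + h y)%E)).

Definition metric_proj (R : realType) (H : normedModType R) (C : set H) (x : H) : H :=
  xget 0 (argmin C (fun y => `|y - x|%:E)).

Definition affine_hull (R : realType) (H : lmodType R) (S : set H) : set H :=
  [set x | exists (n : nat) (p : 'I_n -> H) (w : 'I_n -> R),
     [/\ forall i, S (p i), \sum_(i < n) w i = 1
       & x = \sum_(i < n) w i *: p i]].

Definition rint (R : realType) (H : normedModType R) (S : set H) : set H :=
  [set x | S x /\
     exists2 r : R, 0 < r & ball x r `&` affine_hull S `<=` S].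

(* Main.v *)
Require Import Defs.
From HB Require Import structures.
From mathcomp Require Import all_boot all_order all_algebra.
From mathcomp Require Import sesquilinear.
From mathcomp Require Import ring lra.
From mathcomp Require Import all_classical all_reals all_analysis.

Set Implicit Arguments.
Unset Strict Implicit.
Unset Printing Implicit Defensive.

Import Order.TTheory GRing.Theory Num.Theory.
Import numFieldNormedType.Exports.

Local Open Scope classical_set_scope.
Local Open Scope ring_scope.

(** Write [JA] for the proximity operator of [kappa f] and [JB] for that of
[kappa g] plus the indicator of [C]. The inner loop is a forward-backward
iteration for computing [JB (z m)], and the outer step is a relaxed
Douglas-Rachford step [z + tau (T z - z)], where
[T z = z + JA (2 JB z - z) - JB z], except that [JB (z m)] is replaced by the
output of the inner loop. Three facts give weak convergence.

(a) The inner loop contracts the distance to [JB (z m)] by the factor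
[1 - lambda gamma / (1 + gamma)], at most [rho], at each iteration: the forward
step is nonexpansive because the gradient of [g] is cocoercive (Baillon-Haddad,
[cocoercive]), and the strongly convex term [1/2 |. - z m|^2] makes the backward
step a strict contraction ([forward_backward_contract]). The rule for [N m] then
propagates, by induction on [m], the bound [xi * rho ^ m] on the error of the
inner loop ([inner_error_decay]). The errors are thus summable, with explicit
geometric tails.

(b) [T] is firmly nonexpansive ([dr_op_firm]). For such an operator with a fixed
point, relaxed iterations with summable errors are quasi-Fejer monotone, have
vanishing residuals since the sum of [tau (2 - tau)] diverges, and converge
weakly to a fixed point by demiclosedness and Opial's argument
([inexact_iteration_weak_cvg]). Weak cluster points are taken along
ultrafilters on the indices: scalar limits exist by compactness of segments and
are represented by a vector by Riesz' theorem ([weak_ultralimit]).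

(c) Fixed points of [T] and solutions correspond through [JB]
([dr_fixed_solution], [solution_dr_fixed]). From a fixed point to a solution one
adds two variational inequalities. The converse is the subdifferential sum rule
at a solution [p], and is where the qualification condition enters. Instead of
separating convex sets in a product space, the multiplier is obtained by
penalization: with [phi = f + dot (grad g p) .], minimize
[phi + (n+1)/2 d_C^2 + 1/2 |. - p|^2] and let [x n] be the minimizer and
[u n = (n+1) (x n - P_C (x n))]. Each [u n] is normal to [C], and up to
[x n - p] its opposite is a subgradient of [phi]. Testing these facts against a
common point [q] of [C] and [dom f] bounds [dot (u n) v] above for all
directions [v] in [C - q] and [q - dom f]. The qualification condition turns this
into pointwise boundedness, whence [u n] is bounded by the Banach-Steinhaus
theorem ([multipliers_bounded]); monotonicity then makes [x n] a Cauchy sequence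
with limit [p], and a weak limit of [u n] is the multiplier
([penalization_multiplier]).

Convex functions with values in the extended reals are handled as pairs of a
domain [D] and a real function [phi] on it, and proximal points through their
variational inequality ([is_prox]). *)

(** * Inner product algebra *)

Section InnerProduct.
Context (R : realType) (H : normedModType R) (dot : {dot H for idfun}).
Implicit Types (x y u v : H) (a : R).

Lemma dotC x y : dot x y = dot y x.
Proof. by rewrite hermC expr0 mul1r. Qed.

Lemma dotDl x y u : dot (x + y) u = dot x u + dot y u.
Proof. exact: linearDl. Qed.

Lemma dotNl x u : dot (- x) u = - dot x u.
Proof. exact: linearNl. Qed.

Lemma dotZl a x u : dot (a *: x) u = a * dot x u.
Proof. exact: linearZl_LR. Qed.

Lemma dotDr x y u : dot u (x + y) = dot u x + dot u y.
Proof. by rewrite dotC dotDl !(dotC u). Qed.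

Lemma dotNr x u : dot u (- x) = - dot u x.
Proof. by rewrite dotC dotNl (dotC u). Qed.

Lemma dotZr a x u : dot u (a *: x) = a * dot u x.
Proof. by rewrite dotC dotZl (dotC u). Qed.

Definition dotE := (dotDl, dotNl, dotZl, dotDr, dotNr, dotZr).

Lemma dot0l u : dot 0 u = 0.
Proof. by rewrite -(scale0r 0) dotZl mul0r. Qed.

Lemma dot0r u : dot u 0 = 0.
Proof. by rewrite dotC dot0l. Qed.

Hypothesis dot_norm : hilbert_norm dot.

Lemma dot_ge0 x : 0 <= dot x x.
Proof. by rewrite -dot_norm sqr_ge0. Qed.

Lemma le_norm_dot x y : dot x x <= dot y y -> `|x| <= `|y|.
Proof. by rewrite -!dot_norm ler_sqr ?nnegrE. Qed.

Lemma dot_eq0 x : dot x x <= 0 -> x = 0.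
Proof.
move=> x0; apply/eqP; rewrite -normr_eq0 -sqrf_eq0 dot_norm.
by rewrite eq_le x0 dot_ge0.
Qed.

Lemma dot_inj x y : (forall u, dot x u = dot y u) -> x = y.
Proof.
move=> xy; apply/eqP; rewrite -subr_eq0; apply/eqP/dot_eq0.
by rewrite dotDl dotNl xy subrr.
Qed.

Lemma dot_le x y : dot x y <= `|x| * `|y|.
Proof.
have [->|y0] := eqVneq y 0; first by rewrite dot0r normr0 mulr0.
have ny : 0 < `|y| by rewrite normr_gt0.
have := dot_ge0 (`|y| ^+ 2 *: x - dot x y *: y).
rewrite !dotE (dotC y x) -!dot_norm => h.
have {}h : 0 <= `|y| ^+ 2 * ((`|x| * `|y|) ^+ 2 - dot x y ^+ 2) by lra.
rewrite pmulr_rge0 ?exprn_gt0// subr_ge0 in h.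
apply: le_trans (ler_norm _) _.
by rewrite -ler_sqr ?nnegrE ?mulr_ge0// real_normK ?num_real.
Qed.

Lemma norm_dot_le x y : `|dot x y| <= `|x| * `|y|.
Proof.
rewrite ler_norml dot_le andbT lerNl -dotNl.
by rewrite -(normrN x) dot_le.
Qed.

Lemma continuous_dotl y : continuous (dot ^~ y).
Proof.
move=> x; apply/cvgrPdist_le => e e0; near=> t.
rewrite -dotNl -dotDl (le_trans (norm_dot_le _ _))//.
rewrite (@le_trans _ _ (`|x - t| * (`|y| + 1)))// ?ler_wpM2l ?lerDl//.
rewrite -ler_pdivlMr ?ltr_wpDl//.
near: t; apply/nbhs_ballP; exists (e / (`|y| + 1)).
  by rewrite /= divr_gt0// ltr_wpDl.
by move=> t; rewrite -ball_normE => /ltW.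
Unshelve. all: by end_near. Qed.

End InnerProduct.

(** Decides identities between linear combinations of vectors, by testing both
sides against an arbitrary vector. *)
Ltac vector_eq dot_norm :=
  apply: (dot_inj dot_norm) => ?; rewrite !(dotDl, dotNl, dotZl); lra.

(** * Proximal points of lower semicontinuous convex functions *)

Section ConvexLsc.
Context (R : realType) (H : completeNormedModType R) (dot : {dot H for idfun}).
Hypothesis dot_norm : hilbert_norm dot.
Implicit Types (D : set H) (phi : H -> R) (x y p : H).

Definition convex_on D phi := forall x y (t : R), D x -> D y -> 0 < t < 1 ->
  D (t *: x + (1 - t) *: y) /\
  phi (t *: x + (1 - t) *: y) <= t * phi x + (1 - t) * phi y.

(** Closedness of the sublevel sets inside [D]: this is lower semicontinuity of
[phi] extended by [+oo] outside [D]. *)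
Definition lsc_on D phi := forall a, closed [set x | D x /\ phi x <= a].

(** The proximal point in variational form: [x - p] is a subgradient of [phi] at
[p]. Monotonicity and nonexpansiveness follow by adding instances of it. *)
Definition is_prox D phi x p :=
  D p /\ forall y, D y -> dot (x - p) (y - p) <= phi y - phi p.

Lemma ge0_of_small (a c : R) :
  (forall t, 0 < t < 1 -> 0 <= a + t * c) -> 0 <= a.
Proof.
move=> h; rewrite leNgt; apply/negP => a0.
have c1 : 0 < `|c| + 1 by rewrite ltr_wpDl.
pose t := Num.min 2^-1 (- a / (2 * (`|c| + 1))).
have t0 : 0 < t.
  by rewrite lt_min invr_gt0 ltr0n/= divr_gt0 ?oppr_gt0// mulr_gt0.
have t1 : t < 1 by rewrite gt_min invf_lt1 ?ltr1n.
have := h t; rewrite t0 t1 => /(_ isT).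
have tc : t * c <= - a / 2.
  rewrite (@le_trans _ _ (t * (`|c| + 1)))//.
    by rewrite ler_wpM2l ?(ltW t0)// (le_trans (ler_norm _))// lerDl.
  by rewrite -ler_pdivlMr// -mulrA -invfM ge_min lexx orbT.
by lra.
Qed.

(** First-order condition for a sum in which only an upper bound of [q] along the
segment, tangent at [p], is known: the convex part [phi] keeps its increment
[phi y - phi p] and [q] contributes the slope [l]. *)
Lemma argmin_variational D phi (q : H -> R) (l c : R) p y :
  convex_on D phi -> D p -> D y ->
  (forall y, D y -> phi p + q p <= phi y + q y) ->
  (forall t, 0 < t < 1 -> q (t *: y + (1 - t) *: p) <= q p + t * l + t ^+ 2 * c) ->
  0 <= phi y - phi p + l.
Proof.
move=> cvx Dp Dy pmin qle; apply: (@ge0_of_small _ c) => t t01.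
have /andP[t0 t1] := t01.
have [Dt phit] := cvx _ _ _ Dy Dp t01.
have := pmin _ Dt; have := qle _ t01 => h1 h2.
rewrite -(pmulr_rge0 _ t0); lra.
Qed.

Lemma is_proxP D phi x p : convex_on D phi ->
  is_prox D phi x p <->
  (D p /\ forall y, D y ->
     phi p + 2^-1 * `|p - x| ^+ 2 <= phi y + 2^-1 * `|y - x| ^+ 2).
Proof.
move=> cvx; split=> -[Dp h]; split=> // y Dy.
  have := h _ Dy; have := dot_ge0 dot_norm (y - p).
  rewrite !dot_norm !dotE.
  rewrite (dotC dot y x) (dotC dot y p) (dotC dot x p); lra.
have := @argmin_variational D phi (fun y => 2^-1 * `|y - x| ^+ 2)
  (dot (p - x) (y - p)) (2^-1 * `|y - p| ^+ 2) p y cvx Dp Dy h.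
rewrite -(opprB x p) dotNl subr_ge0; apply=> t _.
rewrite -dotNl !dot_norm !dotE.
rewrite (dotC dot y x) (dotC dot y p) (dotC dot x p); lra.
Qed.

Lemma is_prox_uniq D phi x p p' : is_prox D phi x p -> is_prox D phi x p' ->
  p = p'.
Proof.
move=> [Dp h] [Dp' h']; apply/eqP; rewrite -subr_eq0; apply/eqP.
apply: (dot_eq0 dot_norm); have := h _ Dp'; have := h' _ Dp.
by rewrite !dotE (dotC dot p' p); lra.
Qed.

Lemma is_prox_monotone D phi x p x' p' :
  is_prox D phi x p -> is_prox D phi x' p' ->
  0 <= dot ((x - p) - (x' - p')) (p - p').
Proof.
move=> [Dp h] [Dp' h']; have := h _ Dp'; have := h' _ Dp.
rewrite -(opprB p p') dotNr (dotDl _ (x - p)) (dotNl _ (x' - p')); lra.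
Qed.

Lemma is_prox_nonexp D phi x p x' p' :
  is_prox D phi x p -> is_prox D phi x' p' -> `|p - p'| <= `|x - x'|.
Proof.
move=> hp hp'; apply: (le_norm_dot dot_norm).
have := is_prox_monotone hp hp'.
have := dot_ge0 dot_norm ((x - x') - (p - p')).
have -> : x - p - (x' - p') = (x - x') - (p - p') by rewrite !opprD !opprK addrACA.
move: (x - x') (p - p') => u v.
by rewrite !dotE (dotC dot v u); lra.
Qed.

Lemma sqr_dist_cvg (u : nat -> H) (K : R) :
  (forall n m, `|u n - u m| ^+ 2 <= K * (n.+1%:R^-1 + m.+1%:R^-1)) ->
  exists l : H, u n @[n --> \oo] --> l.
Proof.
move=> h; suff cu : cvgn u by exists (lim (u @ \oo)).
apply/cauchy_cvgP/cauchy_exP => e e0.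
pose k := Num.truncn (2 * `|K| / e ^+ 2); exists (u k).
exists k => // n /= kn; rewrite -ball_normE /=.
rewrite -ltr_sqr ?nnegrE ?(ltW e0)//; apply: le_lt_trans (h _ _) _.
have nk : n.+1%:R^-1 <= k.+1%:R^-1 :> R by rewrite lef_pV2 ?posrE// ler_nat.
have k0 : 0 <= k.+1%:R^-1 :> R by rewrite invr_ge0.
have n0 : 0 <= n.+1%:R^-1 :> R by rewrite invr_ge0.
rewrite (@le_lt_trans _ _ (2 * `|K| * k.+1%:R^-1))//.
  rewrite (@le_trans _ _ (`|K| * (k.+1%:R^-1 + n.+1%:R^-1)))//.
    by rewrite ler_wpM2r ?addr_ge0// ler_norm.
  by rewrite (mulrC 2) -mulrA ler_wpM2l// mulr_natl mulr2n lerD2l.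
rewrite ltr_pdivrMr// [ltRHS]mulrC -ltr_pdivrMr ?exprn_gt0//.
by rewrite truncnS_gt.
Qed.

Lemma lsc_cvg D phi (T : Type) (F : set_system T) (u : T -> H) (b : T -> R) l bl :
  ProperFilter F -> lsc_on D phi -> (forall n, D (u n)) ->
  (forall n, phi (u n) <= b n) ->
  u n @[n --> F] --> l -> b n @[n --> F] --> bl -> D l /\ phi l <= bl.
Proof.
move=> FF lsc Du ub ul bbl.
have key e : 0 < e -> D l /\ phi l <= bl + e.
  move=> e0; apply: (closed_cvg _ (lsc (bl + e)) _ _ ul); near=> n.
  split => //=; apply: le_trans (ub n) _; near: n.
  by apply: (cvgr_le bl) => //; rewrite ltrDl.
split; first exact: (key 1 ltr01).1.
by apply/ler_addgt0Pr => e /key[].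
Unshelve. all: by end_near. Qed.

(** By lower semicontinuity [phi > phi x0 - 1] on a ball around [x0]; convexity
along the segment from [x0] to a far point [y] passes this to a bound
proportional to the distance. Any such minorant is dominated by a square. *)
Lemma conical_minorant D phi x0 : convex_on D phi -> lsc_on D phi -> D x0 ->
  exists2 r, 0 < r & forall y, D y -> phi x0 - 1 - `|y - x0| / r <= phi y.
Proof.
move=> cvx lsc Dx0.
have /open_nbhs_nbhs : open_nbhs x0 (~` [set x | D x /\ phi x <= phi x0 - 1]).
  split; first by rewrite openC; exact: lsc.
  by case=> _ /= ?; lra.
move=> /nbhs_ballP[e /= e0 he]; exists (e / 2); first by rewrite divr_gt0.
have out y : D y -> `|y - x0| < e -> phi x0 - 1 < phi y.
  move=> Dy ye; rewrite ltNge; apply/negP => yle.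
  by apply: (he y) => //; rewrite -ball_normE /= distrC.
move=> y Dy; have [ye|ye] := ltP `|y - x0| e.
  rewrite (le_trans _ (ltW (out _ Dy ye)))// gerBl divr_ge0//.
  by rewrite divr_ge0// ltW.
set d := `|y - x0| in ye *.
have d0 : 0 < d by exact: lt_le_trans ye.
have t0 : 0 < e / 2 / d by rewrite !divr_gt0.
have t1 : e / 2 / d < 1.
  by rewrite ltr_pdivrMr// mul1r (lt_le_trans _ ye)// gtr_pMr// invf_lt1// ltr1n.
have [|Dt phit] := cvx y x0 (e / 2 / d) Dy Dx0; first by rewrite t0 t1.
have := out _ Dt; have -> : (e / 2 / d) *: y + (1 - e / 2 / d) *: x0 - x0 =
    (e / 2 / d) *: (y - x0).
  by rewrite scalerBl scale1r scalerBr addrCA addrAC subrr add0r.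
rewrite normrZ gtr0_norm// -/d divfK ?gt_eqF//.
rewrite gtr_pMr// invf_lt1// ltr1n => /(_ isT) h.
have : - 1 < (e / 2 / d) * (phi y - phi x0) by lra.
rewrite mulrC -ltr_pdivrMr// invf_div mulN1r => {}h; lra.
Qed.

(** The conical minorant bounds [phi + 1/2 |. - x|^2] below, and its minimizing
sequences are Cauchy by the parallelogram identity at midpoints. *)
Lemma is_prox_exists D phi x : D !=set0 -> convex_on D phi -> lsc_on D phi ->
  exists p, is_prox D phi x p.
Proof.
move=> [x0 Dx0] cvx lsc.
pose F y := phi y + 2^-1 * `|y - x| ^+ 2.
have [r r0 minor] := conical_minorant cvx lsc Dx0.
have lb : has_lbound [set F y | y in D].
  exists (phi x0 - 1 - `|x - x0| / r - 2^-1 * (r^-1) ^+ 2) => _ [y Dy <-].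
  have := minor _ Dy.
  have : `|y - x0| / r <= `|y - x| / r + `|x - x0| / r.
    by rewrite -mulrDl ler_wpM2r ?invr_ge0 ?(ltW r0)// ler_distD.
  have := sqr_ge0 (`|y - x| - r^-1).
  rewrite /F; lra.
pose I := inf [set F y | y in D].
have FI y : D y -> I <= F y by move=> Dy; apply: ge_inf => //; exists y.
have hi : has_inf [set F y | y in D] by split => //; exists (F x0), x0.
have /choice[u hu] n : exists y, D y /\ F y < I + n.+1%:R^-1.
  have [|_ [y Dy <-] ?] := @inf_adherent _ _ n.+1%:R^-1 _ hi.
    by rewrite invr_gt0.
  by exists y.
have [n m|p up] := @sqr_dist_cvg u 4.
  have := (hu n).2; have := (hu m).2.
  have half01 : 0 < (2^-1 : R) < 1 by rewrite invr_gt0 ltr0n invf_lt1 ?ltr1n.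
  have [Dm phim] := cvx _ _ _ (hu n).1 (hu m).1 half01.
  have := FI _ Dm; rewrite /F.
  set a := u n in phim *; set b := u m in phim *.
  have -> : `|2^-1 *: a + (1 - 2^-1) *: b - x| ^+ 2 =
     2^-1 * `|a - x| ^+ 2 + 2^-1 * `|b - x| ^+ 2 - 4^-1 * `|a - b| ^+ 2.
    rewrite !dot_norm !dotE (dotC dot b a) (dotC dot x a) (dotC dot x b); lra.
  by move: n.+1%:R^-1 m.+1%:R^-1 phim => ? ? ?; lra.
have cI : I + n.+1%:R^-1 @[n --> \oo] --> I.
  rewrite -[X in _ --> X]addr0; apply: cvgD; first exact: cvg_cst.
  exact: cvg_harmonic.
have cn : (2^-1 * `|u n - x| ^+ 2) @[n --> \oo] --> 2^-1 * `|p - x| ^+ 2.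
  apply: cvgMr; rewrite !expr2; apply: cvgM;
    by apply: cvg_norm; apply: cvgB => //; exact: cvg_cst.
have hb n : phi (u n) <= I + n.+1%:R^-1 - 2^-1 * `|u n - x| ^+ 2.
  by rewrite lerBrDr ltW//; exact: (hu n).2.
have [Dp phip] := @lsc_cvg D phi nat \oo u
   (fun n => I + n.+1%:R^-1 - 2^-1 * `|u n - x| ^+ 2) p
   (I - 2^-1 * `|p - x| ^+ 2) _ lsc (fun n => (hu n).1)
   hb up (cvgB cI cn).
exists p; apply/is_proxP => //; split => // y /FI; rewrite /F; lra.
Qed.

End ConvexLsc.

(** * Riesz representation and weak limits along ultrafilters *)

Section Hilbert.
Context (R : realType) (H : completeNormedModType R) (dot : {dot H for idfun}).
Hypothesis dot_norm : hilbert_norm dot.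
Implicit Types (D : set H) (phi : H -> R) (x y p : H).

Lemma lsc_onD D phi (q : H -> R) : lsc_on D phi -> continuous q ->
  lsc_on D (fun y => phi y + q y).
Proof.
move=> lsc qc a x xcl.
have key e : 0 < e -> D x /\ phi x <= a - q x + e.
  move=> e0; apply: (lsc (a - q x + e)) => B Bx.
  have near_q : nbhs x [set y | q x - e <= q y].
    by apply: (cvgr_ge (q x)); [exact: qc|rewrite gtrBl].
  have [y [[Dy yle] [By qy]]] := xcl _ (filterI Bx near_q).
  by exists y; split => //; split => //; rewrite /= in qy *; lra.
split; first exact: (key 1 ltr01).1.
by rewrite -lerBrDr; apply/ler_addgt0Pr => e /key[].
Qed.

Lemma lsc_on_cst D : closed D -> lsc_on D (fun=> 0 : R).
Proof.
move=> cD a; have [a0|a0] := lerP 0 a.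
  by rewrite (_ : [set _ | _] = D)//; apply/seteqP; split => [y []|y].
rewrite (_ : [set _ | _] = set0)//; first exact: closed0.
by rewrite -subset0 => y [].
Qed.

Lemma lsc_on_continuous D (q : H -> R) : closed D -> continuous q -> lsc_on D q.
Proof.
move=> cD qc; have := lsc_onD (lsc_on_cst cD) qc.
by congr lsc_on; apply/funext => y; rewrite add0r.
Qed.

(** The representing vector is the proximal point of [- L] at the origin. *)
Lemma riesz (L : H -> R) (M : R) :
  (forall x y, L (x + y) = L x + L y) -> (forall a x, L (a *: x) = a * L x) ->
  (forall x, `|L x| <= M * `|x|) -> exists u, forall v, L v = dot u v.
Proof.
move=> LD LZ LM.
have Lc : continuous (fun x => - L x).
  move=> x; apply: cvgN; apply/cvgrPdist_le => e e0.
  apply/nbhs_ballP; exists (e / (`|M| + 1)).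
    by rewrite /= divr_gt0// ltr_wpDl.
  move=> t; rewrite -ball_normE /= => /ltW xt.
  have -> : L x - L t = L (x - t) by rewrite -(scaleN1r t) LD LZ; lra.
  rewrite (le_trans (LM _))// (@le_trans _ _ ((`|M| + 1) * `|x - t|))//.
    by rewrite ler_wpM2r// (le_trans (ler_norm _))// lerDl.
  by rewrite -ler_pdivlMl ?ltr_wpDl// mulrC.
have [|||p [_ hp]] := @is_prox_exists _ _ _ dot_norm setT (fun x => - L x) 0.
- by exists 0.
- by move=> x y t _ _ _; split => //; rewrite LD !LZ; lra.
- by apply: lsc_on_continuous => //; exact: closedT.
exists p => v.
have h w : L w <= dot p w.
  have := hp (p + w) I; rewrite LD (addrC p) addrK sub0r dotNl; lra.
apply/eqP; rewrite eq_le h/=.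
have := h (- v); rewrite -(scaleN1r v) LZ dotZr; lra.
Qed.

(** Bounded sequences have weak limits along ultrafilters: the scalar limits
[lim dot (u n) y] exist by compactness of segments and are represented by a
vector. *)
Lemma weak_ultralimit (u : nat -> H) (M : R) (F : set_system nat) :
  UltraFilter F -> (forall n, `|u n| <= M) ->
  exists l, forall y, dot (u n) y @[n --> F] --> dot l y.
Proof.
move=> UF uM; have PF : ProperFilter F := @ultra_proper _ _ UF.
have uyM y n : `|dot y (u n)| <= M * `|y|.
  by rewrite (le_trans (norm_dot_le dot_norm _ _))// mulrC ler_wpM2r.
have /choice[L hL] y : exists a : R, dot y (u n) @[n --> F] --> a.
  have cpt := @segment_compact R (- (M * `|y|)) (M * `|y|).
  have [|a [_ acl]] := cpt (dot y (u n) @[n --> F]) _.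
    apply: nearW => n /=.
    by rewrite in_itv/= -ler_norml.
  exists a => B Ba; rewrite /nbhs/=.
  have [//|FC] := in_ultra_setVsetC ((fun n => dot y (u n)) @^-1` B) UF.
  by have [b []] := acl (~` B) B FC Ba.
have uniq (h : nat -> R) (a b : R) : h @ F --> a -> h @ F --> b -> a = b.
  move=> ha hb; rewrite -(cvg_lim (@Rhausdorff R) ha).
  exact: (cvg_lim (@Rhausdorff R)).
have [x y|a x|x|l hl] := @riesz L M.
- apply: (uniq (fun n => dot (x + y) (u n))) => //.
  under eq_cvg do rewrite dotDl.
  exact: cvgD.
- apply: (uniq (fun n => dot (a *: x) (u n))) => //.
  under eq_cvg do rewrite dotZl.
  exact: cvgMr.
- apply: (@closed_cvg _ _ F _ (fun n => `|dot x (u n)|) [set a | a <= M * `|x|]).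
  + exact: closed_le.
  + by apply: nearW => n; exact: uyM.
  + by apply: cvg_norm; exact: hL.
exists l => y; rewrite -hl; under eq_cvg do rewrite dotC.
exact: hL.
Qed.

End Hilbert.

(** * Convex functions with Lipschitz gradient *)

Section Gradient.
Context (R : realType) (H : completeNormedModType R) (dot : {dot H for idfun}).
Hypothesis dot_norm : hilbert_norm dot.
Implicit Types (x y : H).

Lemma gradientP (g : H -> R) x h : differentiable g x ->
  'd g x h = dot (gradient dot g x) h.
Proof.
move=> dg; suff [u hu] : exists u, forall v, 'd g x v = dot u v.
  move: h; apply: (@xgetPex _ 0 [set v | forall h, 'd g x h = dot v h]).
  by exists u.
have /linear_boundedP/pinfty_ex_gt0[M M0 hM] : bounded_near ('d g x) (nbhs 0).
  by apply/linear_bounded_continuous; exact: diff_continuous.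
apply: (riesz dot_norm (M := M)) => //.
- by move=> a b; rewrite linearD.
- by move=> a b; rewrite linearZ.
Qed.

(** The difference quotient of a convex function along [y - x] stays below
[g y - g x] at every step in ]0, 1[. *)
Lemma gradient_le (g : H -> R) x y : convex_on setT g -> differentiable g x ->
  g x + dot (gradient dot g x) (y - x) <= g y.
Proof.
move=> cvx dg; rewrite -gradientP// -deriveE// leNgt; apply/negP => lt.
have {}lt : g y - g x < 'D_(y - x) g x by rewrite ltrBlDl.
have : derivable g x (y - x) by exact: diff_derivable.
move=> /cvgr_gt/(_ _ lt) /=.
move=> /nbhs_ballP[e /= e0 he].
pose t := Num.min (e / 2) 2^-1.
have t0 : 0 < t by rewrite lt_min divr_gt0//= invr_gt0.
have t1 : t < 1 by rewrite gt_min invf_lt1 ?ltr1n// orbT.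
have te : t < e by rewrite gt_min gtr_pMr// invf_lt1// ltr1n.
have := he t; rewrite /= -ball_normE /= sub0r normrN gtr0_norm//.
move=> /(_ te)/(_ (lt0r_neq0 t0)).
rewrite ltNge => /negP; apply.
rewrite /GRing.scale/= ler_pdivrMl//.
have [|_] := cvx y x t I I; first by rewrite t0 t1.
have -> : t *: (y - x) + x = t *: y + (1 - t) *: x.
  by rewrite scalerBr scalerBl scale1r -addrA (addrC (- _)).
by move: (g _) => gt; lra.
Qed.

Section Lipschitz.
Variables (g : H -> R) (dg : H -> H) (beta : R).
Hypothesis beta_gt0 : 0 < beta.
Hypothesis subg : forall x y, g x + dot (dg x) (y - x) <= g y.
Hypothesis lip : forall x y, `|dg x - dg y| <= beta * `|x - y|.

(** If the quadratic upper bound holds with some constant [c], applying it on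
the two halves of the segment [x, y] improves [c] to [c / 2 + beta / 4], and
[beta / 2] is the fixed point of this map; monotonicity of the gradient gives
the initial value [c = beta]. *)
Lemma descent x y :
  g y <= g x + dot (dg x) (y - x) + beta / 2 * `|y - x| ^+ 2.
Proof.
have key n : forall x y, g y <= g x + dot (dg x) (y - x) +
   (beta / 2 + beta / 2 * (2^-1) ^+ n) * `|y - x| ^+ 2.
  elim: n => [|n IH] a b.
    have := subg b a; have := dot_le dot_norm (dg b - dg a) (b - a).
    have := ler_wpM2r (normr_ge0 (b - a)) (lip b a).
    rewrite -[a - b]opprB dotNr dotDl dotNl expr0.
    by move: (`|b - a|) (`|dg b - dg a|) => r s; lra.
  pose m := 2^-1 *: (a + b).
  have e1 : m - a = 2^-1 *: (b - a).
    apply: (@scalerI _ _ 2) => //; rewrite /m scalerBr !scalerA divff//.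
    by rewrite !scale1r scaler_nat mulr2n opprD addrACA subrr add0r.
  have e2 : b - m = 2^-1 *: (b - a).
    have -> : b - m = (b - a) - (m - a) by rewrite opprB addrA subrK.
    by rewrite e1 -{1}[b - a]scale1r -scalerBl; congr (_ *: _); lra.
  have := IH a m; have := IH m b; rewrite e1 e2.
  have : dot (dg m - dg a) (b - a) <= beta / 2 * `|b - a| ^+ 2.
    apply: (le_trans (dot_le dot_norm _ _)).
    rewrite expr2 mulrA ler_wpM2r// (le_trans (lip _ _))//.
    by rewrite e1 normrZ gtr0_norm ?invr_gt0// mulrA.
  rewrite !dotZr dotDl dotNl !normrZ !exprMn ger0_norm ?invr_ge0// (exprS _ n).
  move: (2^-1 ^+ n) => p; move: (`|b - a|) => r; lra.
apply/ler_addgt0Pr => e e0.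
pose r := beta / 2 * `|y - x| ^+ 2.
have r0 : 0 <= r by rewrite mulr_ge0 ?sqr_ge0// divr_ge0// ltW.
have : (fun n => r * (2^-1) ^+ n) @ \oo --> r * 0.
  apply: cvgMr; apply: cvg_expr; rewrite ger0_norm ?invr_ge0//.
  by rewrite invf_lt1 ?ltr1n.
rewrite mulr0 => /cvgr_lt/(_ e e0)[n _ /(_ n (leqnn n))/= hn].
have := key n x y; rewrite -/r; move: hn; rewrite /r; lra.
Qed.

(** Both sides bound the same function: [g - dot (dg x) _] is minimal at [x],
hence below its value after a gradient step of length [1 / beta] from [y]. *)
Lemma cocoercive_half x y :
  g x + dot (dg x) (y - x) + (2 * beta)^-1 * `|dg y - dg x| ^+ 2 <= g y.
Proof.
have [d dE] : exists d, d = dg y - dg x by eexists.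
have := subg x (y - beta^-1 *: d).
have := descent y (y - beta^-1 *: d).
have -> : y - beta^-1 *: d - y = - (beta^-1 *: d).
  by rewrite addrAC subrr add0r.
rewrite -dE normrN normrZ exprMn !dot_norm.
rewrite real_normK ?num_real//.
have -> : beta / 2 * (beta^-1 ^+ 2 * dot d d) = (2 * beta)^-1 * dot d d.
  by field; rewrite lt0r_neq0.
rewrite !dotDr !dotNr !dotZr.
have -> : beta^-1 * dot (dg y) d = beta^-1 * (dot (dg x) d + dot d d).
  by rewrite -dotDl {2}dE [dg x + _]addrC subrK.
have -> : beta^-1 * (dot (dg x) d + dot d d) =
  beta^-1 * dot (dg x) d + 2 * ((2 * beta)^-1 * dot d d).
  by field; rewrite lt0r_neq0.
by lra.
Qed.

(** The Baillon-Haddad theorem: sum of the previous inequality and of the one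
with [x] and [y] exchanged. *)
Lemma cocoercive x y :
  `|dg x - dg y| ^+ 2 <= beta * dot (dg x - dg y) (x - y).
Proof.
have := cocoercive_half x y; have := cocoercive_half y x.
rewrite (distrC (dg y)); set n2 := `|_| ^+ 2 => h1 h2.
have -> : n2 = beta * (2 * ((2 * beta)^-1 * n2)).
  by field; rewrite lt0r_neq0.
rewrite ler_pM2l//; move: h1 h2; rewrite -(opprB x y) dotNr (dotDl _ (dg x)) dotNl.
by lra.
Qed.

(** Expanding the square, the cross term [2 t dot (dg x - dg y) (x - y)] absorbs
[t^2 |dg x - dg y|^2] by cocoercivity as soon as [t <= 2 / beta]. *)
Lemma gradient_step_nonexp (t : R) x y : 0 <= t -> t * beta <= 2 ->
  `|(x - t *: dg x) - (y - t *: dg y)| <= `|x - y|.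
Proof.
move=> t0 tb; apply: (le_norm_dot dot_norm).
have -> : (x - t *: dg x) - (y - t *: dg y) = (x - y) - t *: (dg x - dg y).
  by rewrite scalerBr !opprD !opprK addrACA.
have := cocoercive x y; have := sqr_ge0 `|dg x - dg y|.
rewrite dot_norm; move: (dg x - dg y) (x - y) => d v h1 h2.
rewrite !dotE (dotC dot v d).
have h3 : t * (t * dot d d) <= t * (2 * dot d v).
  rewrite ler_wpM2l// (le_trans (ler_wpM2l t0 h2))// mulrA ler_wpM2r//.
  by rewrite -(pmulr_rge0 _ beta_gt0) (le_trans h1).
lra.
Qed.

End Lipschitz.
End Gradient.

(** * Inexact iterations of firmly nonexpansive operators *)

Section FirmlyNonexpansive.
Context (R : realType) (H : completeNormedModType R) (dot : {dot H for idfun}).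
Hypothesis dot_norm : hilbert_norm dot.
Implicit Types (T : H -> H) (x y w l : H).

Definition firmly_nonexp T := forall x y,
  0 <= dot (T x - T y) ((x - T x) - (y - T y)).

Lemma firmly_nonexp_lip T x y : firmly_nonexp T -> `|T x - T y| <= `|x - y|.
Proof.
move=> firm; apply: (le_norm_dot dot_norm); have := firm x y.
have := dot_ge0 dot_norm ((x - y) - (T x - T y)).
have -> : x - T x - (y - T y) = (x - y) - (T x - T y).
  by rewrite !opprD !opprK addrACA.
move: (x - y) (T x - T y) => u v.
rewrite !dotE (dotC dot v u); lra.
Qed.

(** Firmness against a fixed point reads
[dot (x - w) (T x - x) <= - |T x - x|^2]. *)
Lemma relaxed_step_fejer T (t : R) x w : firmly_nonexp T -> T w = w -> 0 <= t ->
  `|x + t *: (T x - x) - w| ^+ 2 <= `|x - w| ^+ 2 - t * (2 - t) * `|T x - x| ^+ 2.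
Proof.
move=> firm Tw t0; have := firm x w; rewrite Tw subrr subr0.
rewrite -(opprB (T x)) dotNr addrAC.
have -> : T x - w = (x - w) + (T x - x) by rewrite [RHS]addrC addrA subrK.
move: (x - w) (T x - x) => a b; rewrite !dot_norm !dotE (dotC dot b a) => h.
have := ler_wpM2l t0 h; lra.
Qed.

(** An exact relaxed step does not increase the residual since [2 T - id] is
nonexpansive, and the residual is 1-Lipschitz since [id - T] is firmly
nonexpansive. *)
Lemma residual_le T (t : R) x x' : firmly_nonexp T -> 0 < t -> t < 2 ->
  `|T x' - x'| <= `|T x - x| + `|x' - (x + t *: (T x - x))|.
Proof.
move=> firm t0 t2.
have exact_step y : y = x + t *: (T x - x) -> `|T y - y| <= `|T x - x|.
  move=> yE; apply: (le_norm_dot dot_norm).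
  have := firm y x; have := dot_ge0 dot_norm ((T y - y) - (T x - x)).
  have -> : T y - T x = (T y - y) - (T x - x) + t *: (T x - x).
    have -> : t *: (T x - x) = y - x by rewrite yE [RHS]addrAC subrr add0r.
    by rewrite opprB (addrAC _ (x - T x)) !addrA !subrK.
  rewrite -(opprB (T y)) -(opprB (T x) x).
  move: (T y - y) (T x - x) => a b; rewrite !dotE (dotC dot b a) => h1 h2.
  have t2' : 0 <= 2 - t by lra.
  by have := mulr_ge0 t2' h1; rewrite -(ler_pM2l t0); lra.
have Qlip a b : `|T a - a| <= `|T b - b| + `|a - b|.
  rewrite -lerBlDl (le_trans (lerB_dist _ _))//; apply: (le_norm_dot dot_norm).
  have := firm a b; have := dot_ge0 dot_norm (T a - T b).
  have -> : a - T a - (b - T b) = (a - b) - (T a - T b).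
    by rewrite !opprD !opprK addrACA.
  have -> : T a - a - (T b - b) = (T a - T b) - (a - b).
    by rewrite !opprD !opprK addrACA.
  move: (a - b) (T a - T b) => u v; rewrite !dotE (dotC dot v u); lra.
apply: (le_trans (Qlip x' (x + t *: (T x - x)))).
by rewrite lerD2r exact_step.
Qed.

(** The errors are bounded by the decrements of [s], which thus plays the role of
the tail of their sum: every quasi-monotone quantity becomes monotone after
adding a multiple of [s]. *)
Section InexactIteration.
Variables (T : H -> H) (z : nat -> H) (tau s : nat -> R) (w0 : H).
Hypothesis firm : firmly_nonexp T.
Hypothesis Tw0 : T w0 = w0.
Hypothesis tau_itv : forall m, 0 < tau m < 2.
Hypothesis tau_sum : forall B : R, exists n,
  B < \sum_(0 <= m < n) tau m * (2 - tau m).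
Hypothesis step : forall m,
  `|z m.+1 - (z m + tau m *: (T (z m) - z m))| <= s m - s m.+1.
Hypothesis s_ge0 : forall m, 0 <= s m.
Hypothesis s_cvg0 : s @ \oo --> (0 : R).

Let step_ge0 m : 0 <= s m - s m.+1.
Proof. exact: le_trans (step m). Qed.

Let tau_prod_ge0 m : 0 <= tau m * (2 - tau m).
Proof. by have /andP[? ?] := tau_itv m; rewrite mulr_ge0; lra. Qed.

Let relaxed_le m w : T w = w ->
  `|z m + tau m *: (T (z m) - z m) - w| <= `|z m - w|.
Proof.
move=> Tw; have /andP[t0 _] := tau_itv m.
rewrite -ler_sqr ?nnegrE// (le_trans (relaxed_step_fejer _ firm Tw (ltW t0)))//.
by rewrite gerBl mulr_ge0// sqr_ge0.
Qed.

Lemma quasi_fejer m w : T w = w -> `|z m.+1 - w| + s m.+1 <= `|z m - w| + s m.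
Proof.
move=> Tw; rewrite -lerBrDr -addrA.
rewrite (le_trans (ler_distD (z m + tau m *: (T (z m) - z m)) _ _))//.
by rewrite addrC lerD// relaxed_le.
Qed.

Lemma dist_le m w : T w = w -> `|z m - w| + s m <= `|z 0%N - w| + s 0%N.
Proof. by move=> Tw; elim: m => // m; apply: le_trans; exact: quasi_fejer. Qed.

Let cvg_of_noninc (a : nat -> R) : (forall m, 0 <= a m) ->
  (forall m, a m.+1 + s m.+1 <= a m + s m) -> exists b, a @ \oo --> (b : R).
Proof.
move=> a0 adec.
have [b cb] : exists b, a m + s m @[m --> \oo] --> (b : R).
  exists (lim ((fun m => a m + s m) @ \oo)).
  apply: nonincreasing_is_cvgn; first exact/nonincreasing_seqP.
  by exists 0 => _ [m _ <-]; rewrite addr_ge0.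
exists b; rewrite -[X in _ --> X]subr0.
have -> : a = (fun m => (a m + s m) - s m) by apply/funext => m; rewrite addrK.
exact: cvgB.
Qed.

Lemma dist_cvg w : T w = w -> exists b, `|z m - w| @[m --> \oo] --> (b : R).
Proof. by move=> Tw; apply: cvg_of_noninc => // m; exact: quasi_fejer. Qed.

Lemma residual_noninc m : `|T (z m.+1) - z m.+1| + s m.+1 <= `|T (z m) - z m| + s m.
Proof.
have /andP[t0 t2] := tau_itv m.
have := residual_le (z m) (z m.+1) firm t0 t2; have := step m; lra.
Qed.

(** Squaring the quasi-Fejer estimate costs a factor bounded by twice the initial
value of [|z m - w0| + s m]. *)
Let V m := `|z m - w0| ^+ 2 + 2 * (`|z 0%N - w0| + s 0%N) * s m.

Let V_decr m : V m.+1 <= V m - tau m * (2 - tau m) * `|T (z m) - z m| ^+ 2.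
Proof.
have /andP[t0 _] := tau_itv m; rewrite /V.
have := relaxed_step_fejer (z m) firm Tw0 (ltW t0).
have := relaxed_le m Tw0; have := step m; have := dist_le m Tw0.
have := ler_distD (z m + tau m *: (T (z m) - z m)) (z m.+1) w0.
have := step_ge0 m; have := s_ge0 m; have := s_ge0 m.+1.
have := normr_ge0 (z m.+1 - w0).
have := normr_ge0 (z m + tau m *: (T (z m) - z m) - w0).
set y := `|z m + _ - w0|; set c := tau m * _ * _; set z' := `|z m.+1 - w0|.
set e := `|z m.+1 - _|; set d := `|z m - w0|; set M := `|z 0%N - w0| + s 0%N.
move: (s m) (s m.+1) => s1 s2 h1 h2 h3 h4 h5 h6 h7 h8 h9 h10.
have k1 : z' ^+ 2 <= (y + (s1 - s2)) ^+ 2.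
  by rewrite ler_sqr ?nnegrE; lra.
have k2 : (s1 - s2) * (2 * y + (s1 - s2)) <= (s1 - s2) * (2 * M).
  by rewrite ler_wpM2l//; lra.
rewrite sqrrD in k1; lra.
Qed.

(** The residuals converge, being monotone up to [s]. A positive limit [b] would
make them eventually exceed [b / 2], and summing the decrease of [V] would bound
the partial sums of [tau (2 - tau)]. *)
Lemma residual_cvg0 : `|T (z m) - z m| @[m --> \oo] --> (0 : R).
Proof.
have [b cb] : exists b, `|T (z m) - z m| @[m --> \oo] --> (b : R).
  by apply: cvg_of_noninc => // m; exact: residual_noninc.
have [b0|b0|<-//] := ltgtP b 0.
  have : 0 <= b.
    by apply: (cvgr_to_ge cb); apply: nearW => m /=.
  by rewrite leNgt b0.
have b2 : b / 2 < b by rewrite gtr_pMr// invf_lt1// ltr1n.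
have [k _ hk] := cvgr_gt _ cb _ b2.
pose c m := tau m * (2 - tau m).
have bound j : \sum_(0 <= m < k + j) c m * (b / 2) ^+ 2 <=
    \sum_(0 <= m < k) c m * (b / 2) ^+ 2 + V k - V (k + j)%N.
  elim: j => [|j IH]; first by rewrite addn0 addrK.
  rewrite addnS big_nat_recr//=; have := V_decr (k + j)%N.
  have : c (k + j)%N * (b / 2) ^+ 2 <= c (k + j)%N * `|T (z (k + j)%N) - z (k + j)%N| ^+ 2.
    rewrite ler_wpM2l ?tau_prod_ge0// ler_sqr ?nnegrE ?divr_ge0 ?(ltW b0)//.
    by apply: ltW; apply: hk; rewrite /= leq_addr.
  by rewrite /c; move: IH; rewrite /c; lra.
have [n hn] := tau_sum ((\sum_(0 <= m < k) c m * (b / 2) ^+ 2 + V k) / (b / 2) ^+ 2).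
have bb : 0 < (b / 2) ^+ 2 by rewrite exprn_gt0// divr_gt0.
have := bound n; rewrite -mulr_suml => hb.
have V0 m : 0 <= V m by rewrite addr_ge0 ?sqr_ge0// !mulr_ge0// addr_ge0.
have : \sum_(0 <= m < n) c m <= \sum_(0 <= m < k + n) c m.
  rewrite (@big_cat_nat _ _ _ n 0%N (k + n)%N) ?leq_addl//= lerDl.
  by apply: sumr_ge0 => m _; exact: tau_prod_ge0.
rewrite ltr_pdivrMr// in hn => hle.
have := V0 (k + n)%N; have := ler_wpM2r (ltW bb) hle.
by rewrite -/(c _) in hn *; lra.
Qed.

(** Demiclosedness: in the firmness inequality between [z m] and [l], the terms
containing the residual [z m - T (z m)] vanish along [F], and what remains is
[|l - T l|^2 <= 0]. *)
Lemma weak_cluster_fixed (F : set_system nat) l : ProperFilter F -> \oo `<=` F ->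
  (forall y, dot (z n) y @[n --> F] --> dot l y) -> T l = l.
Proof.
move=> PF subF hl; apply/esym/eqP; rewrite -subr_eq0; apply/eqP.
apply: (dot_eq0 dot_norm); rewrite [X in X <= _]dotDl dotNl subr_le0.
pose K := `|z 0%N - w0| + s 0%N + `|w0 - l| + `|l - T l|.
have hK m : dot (z m) (l - T l) <= dot (T l) (l - T l) + K * `|T (z m) - z m|.
  have := firm (z m) l.
  have := dot_le dot_norm (T (z m) - T l) (z m - T (z m)).
  have := dot_le dot_norm (z m - T (z m)) (l - T l).
  rewrite (distrC (z m) (T (z m))).
  have := firmly_nonexp_lip (z m) l firm.
  have := ler_distD w0 (z m) l.
  have := dist_le m Tw0; have := s_ge0 m; have := normr_ge0 (T (z m) - z m).
  have -> : dot (z m) (l - T l) = dot (z m - T (z m)) (l - T l) +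
     dot (T (z m) - T l) (l - T l) + dot (T l) (l - T l).
    by rewrite -!dotDl addrA !subrK.
  rewrite dotDr dotNr /K.
  move: `|T (z m) - z m| => r r0 h1 h2 h3 h4 h5 h6 h7.
  have h8 : `|T (z m) - T l| * r <= (`|z 0%N - w0| + s 0%N + `|w0 - l|) * r.
    by rewrite ler_wpM2r//; lra.
  by lra.
apply: (ler_cvg_to (hl (l - T l))
  (g := fun m => dot (T l) (l - T l) + K * `|T (z m) - z m|)).
- rewrite -[X in _ --> X]addr0; apply: cvgD; first exact: cvg_cst.
  rewrite -[X in _ --> X](mulr0 K); apply: cvgMr.
  by apply: cvg_trans residual_cvg0 => A /subF.
- by apply: nearW => m; exact: hK.
Qed.

(** Two weak cluster points [l] and [l'] are fixed points, so that
[dot (z m) (l - l')], a combination of the squared distances to them,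
converges: this is Opial's argument. *)
Lemma weak_cluster_unique (F G : set_system nat) l l' :
  ProperFilter F -> \oo `<=` F -> ProperFilter G -> \oo `<=` G ->
  (forall y, dot (z n) y @[n --> F] --> dot l y) ->
  (forall y, dot (z n) y @[n --> G] --> dot l' y) -> l = l'.
Proof.
move=> PF subF PG subG hF hG.
have Tl := weak_cluster_fixed PF subF hF.
have Tl' := weak_cluster_fixed PG subG hG.
have [b hb] := dist_cvg Tl; have [b' hb'] := dist_cvg Tl'.
pose c := 2^-1 * ((b' * b' - b * b) + (dot l l - dot l' l')).
have hc : dot (z m) (l - l') @[m --> \oo] --> c.
  have E m : dot (z m) (l - l') =
      2^-1 * ((`|z m - l'| * `|z m - l'| - `|z m - l| * `|z m - l|) +
      (dot l l - dot l' l')).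
    rewrite -!expr2 !dot_norm !dotE (dotC dot l (z m)) (dotC dot l' (z m)); lra.
  under eq_cvg do rewrite E.
  by apply: cvgMr; apply: cvgD; [apply: cvgB; apply: cvgM|exact: cvg_cst].
have lc : dot l (l - l') = c.
  have hc' : dot (z m) (l - l') @[m --> F] --> c by apply: cvg_trans hc => A /subF.
  by rewrite -(cvg_lim (@Rhausdorff R) hc'); apply/esym; exact: (cvg_lim (@Rhausdorff R)).
have l'c : dot l' (l - l') = c.
  have hc' : dot (z m) (l - l') @[m --> G] --> c by apply: cvg_trans hc => A /subG.
  by rewrite -(cvg_lim (@Rhausdorff R) hc'); apply/esym; exact: (cvg_lim (@Rhausdorff R)).
apply/eqP; rewrite -subr_eq0; apply/eqP; apply: (dot_eq0 dot_norm).
by rewrite dotDl dotNl lc l'c subrr.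
Qed.

(** If [dot (z m) y] stayed away from [dot l y] infinitely often, an ultrafilter
concentrated on those indices would yield a second weak cluster point. *)
Theorem inexact_iteration_weak_cvg :
  exists l, T l = l /\ weakly_cvg_to dot z l.
Proof.
have zM m : `|z m| <= `|z 0%N - w0| + s 0%N + `|w0|.
  have := ler_normD (z m - w0) w0; rewrite subrK.
  have := dist_le m Tw0; have := s_ge0 m; lra.
have [U [UU subU]] := ultraFilterLemma eventually_filter.
have [l hl] := weak_ultralimit dot_norm UU zM.
exists l; split; first exact: weak_cluster_fixed hl.
move=> y; apply/cvgrPdist_le => e e0; apply/not_notP => hfar.
pose A := [set m | ~ `|dot l y - dot (z m) y| <= e].
have PA : ProperFilter (within A \oo).
  apply: Build_ProperFilter => -[k _ hk]; apply: hfar; exists k => // m km.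
  by apply/not_notP => hm; exact: hk hm.
have [G [UG subG]] := ultraFilterLemma PA.
have subG' : \oo `<=` G.
  by move=> B hB; apply: subG; apply: filterS hB => m ? ?.
have [l' hl'] := weak_ultralimit dot_norm UG zM.
have ll' : l = l' by apply: weak_cluster_unique hl hl'.
have GA : G A by apply: subG; apply: nearW.
have := hl' y; rewrite -ll' => /cvgrPdist_le/(_ e e0) Gl.
by have [m [/= hm]] := filter_ex (filterI GA Gl).
Qed.

End InexactIteration.
End FirmlyNonexpansive.

(** * Orthogonal projection in finite dimension *)

Section FiniteDimension.
Context (R : realType) (H : normedModType R) (dot : {dot H for idfun}).
Hypothesis dot_norm : hilbert_norm dot.

Definition is_subspace (W : set H) :=
  W 0 /\ forall (a : R) x y, W x -> W y -> W (a *: x + y).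

Definition spanned n (e : 'I_n -> H) : set H :=
  [set x | exists c : 'I_n -> R, x = \sum_(i < n) c i *: e i].

(** Induction on the number of generators: if [w] in [W] needs the last
generator, [W] is the orthogonal sum of its intersection [W'] with the span of
the others and of the line through the component [d] of [w] orthogonal to
[W']. *)
Lemma orthogonal_projection n (e : 'I_n -> H) (W : set H) :
  is_subspace W -> W `<=` spanned e ->
  forall y, exists2 y', W y' & forall v, W v -> dot v (y - y') = 0.
Proof.
elim: n e W => [|n IH] e W [W0 WD] Wspan.
  move=> y; exists 0 => // v /Wspan[c ->].
  by rewrite big_ord0 dot0l.
pose e' i := e (widen_ord (leqnSn n) i).
pose W' : set H := W `&` spanned e'.
have subW' : is_subspace W'.
  split; first by split => //; exists (fun=> 0); rewrite big1// => i _; rewrite scale0r.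
  move=> a x y [Wx [c xE]] [Wy [d yE]]; split; first exact: WD.
  exists (fun i => a * c i + d i); rewrite xE yE scaler_sumr -big_split/=.
  by apply: eq_bigr => i _; rewrite scalerDl scalerA.
have [W'span|] := pselect (W `<=` spanned e'); first exact: (IH e' W).
move=> /existsNP[w /not_implyP[Ww wN]].
have proj' := IH e' W' subW' (@subIsetr _ _ _).
have split_last v : W v -> exists a s, spanned e' s /\ v = s + a *: e ord_max.
  move=> /Wspan[c ->]; exists (c ord_max), (\sum_(i < n) c (widen_ord (leqnSn n) i) *: e' i).
  by split; [exists (fun i => c (widen_ord (leqnSn n) i))|rewrite big_ord_recr].
have [c [s [[cs sE] wE]]] := split_last _ Ww.
have c0 : c != 0.
  apply/eqP => c0; apply: wN; exists cs; rewrite wE c0 scale0r addr0; exact: sE.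
have [w' [Ww' [cw' w'E]] ortw'] := proj' w.
have W'w' : W' w' by split => //; exists cw'.
pose d := w - w'.
have Wd : W d by rewrite /d addrC -scaleN1r; exact: (WD _ _ _ Ww' Ww).
have d0 : dot d d != 0.
  apply/eqP => dd; apply: wN; exists cw'; rewrite -w'E.
  by apply/eqP; rewrite -subr_eq0 -/d; apply/eqP/(dot_eq0 dot_norm); rewrite dd.
have decomp v : W v -> exists a v', W' v' /\ v = a *: d + v'.
  move=> Wv; have [cv [sv [[csv svE] vE]]] := split_last _ Wv.
  pose a := cv / c; pose v0 := v - a *: w.
  have Wv0 : W' v0.
    split; first by rewrite /v0 addrC -scaleNr; exact: (WD _ _ _ Ww Wv).
    exists (fun i => csv i - a * cs i).
    have -> : v0 = sv - a *: s.
      rewrite /v0 vE wE scalerDr opprD addrACA scalerA /a divfK// subrr addr0.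
      by [].
    rewrite svE sE scaler_sumr -sumrB.
    by apply: eq_bigr => i _; rewrite scalerBl scalerA.
  exists a, (a *: w' + v0); split; first exact: (subW'.2 a w' v0).
  by rewrite addrA -scalerDr /d subrK /v0 addrC subrK.
move=> y; have [y' Wy' orty'] := proj' y.
exists (dot y d / dot d d *: d + y'); first exact: (WD _ _ _ Wd Wy'.1).
move=> v /decomp[a [v' [Wv' ->]]].
have ort0 t : W' t -> dot t d = 0 by exact: ortw'.
have h1 := ort0 _ Wv'; have h2 := ort0 _ Wy'; have h3 := orty' _ Wv'.
have -> : y - (dot y d / dot d d *: d + y') = (y - y') - (dot y d / dot d d) *: d.
  by rewrite opprD addrA addrAC.
rewrite dotDl dotZl !(dotDr dot (y - y')) h3 !dotNr !dotZr h1 mulr0 oppr0 !addr0.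
by rewrite divfK// dotDr dotNr (dotC dot d y') h2 (dotC dot d y) subr0 subrr mulr0.
Qed.
End FiniteDimension.

(** * Existence of a multiplier by penalization *)

Section Multiplier.
Context (R : realType) (H : completeNormedModType R) (dot : {dot H for idfun}).
Hypothesis dot_norm : hilbert_norm dot.

(** One-sided bounds suffice in Banach-Steinhaus because [- v] is also tested. *)
Lemma pointwise_bounded_seq (u : nat -> H) :
  (forall v, exists M, forall n, dot (u n) v <= M) ->
  exists M, forall n, `|u n| <= M.
Proof.
move=> ub.
have [||M hM] := @Banach_Steinhauss R H R^o
    [set (fun v => dot (u n) v : R^o) | n in setT] _ _ 1.
- move=> _ [n _ <-]; split.
    move=> r; exists (`|u n| * r) => x xr.
    by rewrite (le_trans (norm_dot_le dot_norm _ _))// ler_wpM2l.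
  by move=> a x y; rewrite dotDr dotZr.
- move=> v; have [M1 h1] := ub v; have [M2 h2] := ub (- v).
  exists (Num.max M1 M2) => _ [n _ <-].
  rewrite ler_norml le_max h1/= andbT lerNl le_max -dotNr h2.
  by rewrite orbT.
exists M => n; have [->|un0] := eqVneq (u n) 0.
  by rewrite normr0 -(normr0 R^o) -(dot0r dot (u n)); apply: hM; [exists n|rewrite normr0].
have := hM (dot (u n)) (ex_intro2 _ _ n I erefl) (`|u n|^-1 *: u n).
rewrite normrZ normfV normr_id mulVf ?normr_eq0// => /(_ (lexx _)).
rewrite dotZr -dot_norm expr2 mulrA mulVf ?normr_eq0// mul1r.
by rewrite normr_id.
Qed.

Section Penalization.
Variables (C D : set H) (phi : H -> R) (p : H).
Hypothesis C_closed : closed C.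
Hypothesis C_convex : convex_on C (fun=> 0 : R).
Hypothesis phi_convex : convex_on D phi.
Hypothesis phi_lsc : lsc_on D phi.
Hypothesis Cp : C p.
Hypothesis Dp : D p.
Hypothesis p_min : forall y, C y -> D y -> phi p <= phi y.

Let is_proj := is_prox dot C (fun=> 0).

Lemma is_proj_normal x q y : is_proj x q -> C y -> dot (x - q) (y - q) <= 0.
Proof. by move=> [_ h] /h; rewrite subrr. Qed.

Lemma is_proj_le x q y : is_proj x q -> C y -> `|x - q| ^+ 2 <= `|x - y| ^+ 2.
Proof.
move=> hq Cy; have := is_proj_normal hq Cy.
have := dot_ge0 dot_norm (y - q); rewrite !dot_norm.
have -> : x - y = (x - q) - (y - q) by rewrite opprB addrA subrK.
move: (x - q) (y - q) => a b; rewrite !dotE (dotC dot b a); lra.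
Qed.

Variable P : H -> H.
Hypothesis P_proj : forall x, is_proj x (P x).

(** The penalty [|. - P .|^2] is the squared distance to [C]. *)
Let sqdist x := `|x - P x| ^+ 2.

Let sqdist_continuous : continuous sqdist.
Proof.
have Pc : continuous P.
  move=> x; apply/cvgrPdist_le => e e0; apply/nbhs_ballP; exists e => // y.
  rewrite -ball_normE /= => /ltW; apply: le_trans.
  exact: is_prox_nonexp (P_proj x) (P_proj y).
by move=> x; rewrite /sqdist; apply: cvgM; apply: cvg_norm; apply: cvgB => //; exact: Pc.
Qed.

(** The convex combination of the projections is a competitor in [C]. *)
Let sqdist_convex x y (t : R) : 0 < t < 1 ->
  sqdist (t *: x + (1 - t) *: y) <= t * sqdist x + (1 - t) * sqdist y.
Proof.
move=> t01; have /andP[t0 t1] := t01.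
have [Cw _] := C_convex (P_proj x).1 (P_proj y).1 t01.
apply: (le_trans (is_proj_le (P_proj _) Cw)).
have -> : t *: x + (1 - t) *: y - (t *: P x + (1 - t) *: P y) =
    t *: (x - P x) + (1 - t) *: (y - P y).
  by rewrite opprD addrACA -!scalerBr.
rewrite /sqdist !dot_norm; move: (x - P x) (y - P y) => a b.
have := dot_ge0 dot_norm (a - b).
have : 0 <= t * (1 - t) by rewrite mulr_ge0; lra.
move=> tt h; have := mulr_ge0 tt h.
rewrite !dotE (dotC dot b a); lra.
Qed.

Let penalized n x := phi x + n.+1%:R / 2 * sqdist x.

Let penalized_convex n : convex_on D (penalized n).
Proof.
move=> x y t Dx Dy t01; have [Dt ht] := phi_convex Dx Dy t01.
split => //; have := sqdist_convex x y t01.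
have n0 : 0 <= n.+1%:R / 2 :> R by rewrite divr_ge0.
move=> /(ler_wpM2l n0); rewrite /penalized.
move: ht; move: (n.+1%:R / 2) (sqdist _) (phi (_ + _)) => k s f; lra.
Qed.

Lemma penalized_prox n : exists x, is_prox dot D (penalized n) p x.
Proof.
apply: is_prox_exists => //; first by exists p.
by apply: lsc_onD => // x; apply: cvgMr; exact: sqdist_continuous.
Qed.

Variable x : nat -> H.
Hypothesis x_prox : forall n, is_prox dot D (penalized n) p (x n).

Let u n := n.+1%:R *: (x n - P (x n)).

Let Dx n : D (x n). Proof. by case: (x_prox n). Qed.

Lemma multiplier_normal n y : C y -> dot (u n) (y - P (x n)) <= 0.
Proof.
by move=> Cy; rewrite dotZl mulr_ge0_le0//; exact: is_proj_normal (P_proj _) Cy.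
Qed.

Lemma multiplier_gap n : 0 <= dot (u n) (x n - P (x n)).
Proof. by rewrite dotZl mulr_ge0//; exact: dot_ge0. Qed.

(** Optimality of [x n]. The squared distance to [C] lies below
[|. - P (x n)|^2] with equality at [x n], and the latter has an explicit
expansion along segments, with slope given by [x n - P (x n)]. *)
Lemma multiplier_subgradient n y : D y ->
  phi (x n) <= phi y + dot (u n + (x n - p)) (y - x n).
Proof.
move=> Dy; rewrite -subr_ge0 addrAC.
have [_ xmin] := (is_proxP dot_norm _ _ (@penalized_convex n)).1 (x_prox n).
pose k : R := n.+1%:R / 2.
apply: (@argmin_variational _ _ D phi
  (fun y => k * sqdist y + 2^-1 * `|y - p| ^+ 2) _
  ((k + 2^-1) * `|y - x n| ^+ 2) (x n) y) => //.
  by move=> w Dw; have := xmin _ Dw; rewrite /penalized -/k; lra.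
move=> t t01.
have k0 : 0 <= k by rewrite divr_ge0.
have := ler_wpM2l k0 (is_proj_le (P_proj (t *: y + (1 - t) *: x n)) (P_proj (x n)).1).
rewrite -/(sqdist (t *: y + (1 - t) *: x n)) => h.
rewrite (le_trans (lerD h (lexx _)))// /sqdist /u.
have split_at w : t *: y + (1 - t) *: x n - w = (x n - w) + t *: (y - x n).
  by rewrite scalerBl scale1r scalerBr addrCA -!addrA; congr (_ + _); rewrite addrA addrC.
rewrite !split_at !dot_norm.
have -> : n.+1%:R = 2 * k :> R by rewrite /k mulrCA divff// mulr1.
move: (x n - P (x n)) (x n - p) (y - x n) => a b d.
rewrite !dotE (dotC dot d a) (dotC dot d b); lra.
Qed.

(** The subgradient inequality at [p], where [dot (u n) (p - x n)] is nonpositive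
because [p] lies in [C]. *)
Lemma penalized_bound n :
  phi (x n) + 2^-1 * `|x n - p| ^+ 2 <= phi p.
Proof.
have := multiplier_subgradient n Dp.
have := multiplier_normal n Cp; have := multiplier_gap n.
have -> : p - P (x n) = (p - x n) + (x n - P (x n)) by rewrite addrA subrK.
rewrite -(opprB (x n) p) dotDl (dotDr _ (- _)) !dotNr dot_norm.
have := dot_ge0 dot_norm (x n - p); lra.
Qed.

Lemma penalized_iterates_bounded : exists B m0 : R,
  forall n, `|x n - p| <= B /\ m0 <= phi (x n).
Proof.
have [r r0 minor] := conical_minorant phi_convex phi_lsc Dp.
have key n : `|x n - p| <= 2 / r + 2.
  have := penalized_bound n; have := minor _ (Dx n).
  have := divr_ge0 ler01 (ltW r0).
  have := normr_ge0 (x n - p); move: (`|x n - p|) r^-1 => s q s0 q0 h1 h2.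
  rewrite leNgt; apply/negP => h; nra.
exists (2 / r + 2), (phi p - 1 - (2 / r + 2) / r) => n; split => //.
have := minor _ (Dx n); apply: le_trans; rewrite lerD2l lerN2.
by rewrite ler_wpM2r// invr_ge0 ltW.
Qed.

(** The directions along which the multipliers are bounded above form a convex
cone, which turns out to contain [C - q] and [q - D]. *)
Let bounded_along v := exists M, forall n, dot (u n) v <= M.

(** The subgradient inequality tested at [q] in [D], where every term but
[dot (u n) _] is bounded since the iterates are. *)
Let bounded_subgradient q : D q ->
  exists M, forall n, - dot (u n) (q - x n) <= M.
Proof.
move=> Dq; have [B [m0 hB]] := penalized_iterates_bounded.
exists (phi q - m0 + B * (`|q - p| + B)) => n.
have := multiplier_subgradient n Dq; have [h1 h2] := hB n.
have := dot_le dot_norm (x n - p) (q - x n).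
have := ler_distD p q (x n); rewrite (distrC p (x n)) (dotDl _ (u n)) => h3 h4 h5.
have B0 : 0 <= B by exact: le_trans h1.
have : `|x n - p| * `|q - x n| <= B * (`|q - p| + B).
  by apply: ler_pM => //; apply: (le_trans h3); rewrite lerD2l.
lra.
Qed.

Lemma bounded_alongC q y : C q -> D q -> C y -> bounded_along (y - q).
Proof.
move=> Cq Dq Cy; have [M hM] := bounded_subgradient Dq.
exists M => n; have := hM n; have := multiplier_normal n Cy.
have := multiplier_gap n.
have -> : y - q = (y - P (x n)) - (x n - P (x n)) - (q - x n).
  by rewrite !opprB !addrA !subrK.
rewrite 2!dotDr !dotNr; lra.
Qed.

Lemma bounded_alongD q y : C q -> D y -> bounded_along (q - y).
Proof.
move=> Cq Dy; have [M hM] := bounded_subgradient Dy.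
exists M => n; have := hM n; have := multiplier_normal n Cq.
have := multiplier_gap n.
have -> : q - y = (q - P (x n)) - (x n - P (x n)) - (y - x n).
  by rewrite !opprB !addrA !subrK.
rewrite 2!dotDr !dotNr; lra.
Qed.

Lemma bounded_alongZ a v : 0 < a -> bounded_along (a *: v) -> bounded_along v.
Proof.
move=> a0 [M hM]; exists (a^-1 * M) => n.
by rewrite ler_pdivlMl// -dotZr.
Qed.

Lemma bounded_along_comb a b v w : 0 <= a -> 0 <= b ->
  bounded_along v -> bounded_along w -> bounded_along (a *: v + b *: w).
Proof.
move=> a0 b0 [M hM] [N hN]; exists (a * M + b * N) => n.
by rewrite dotDr !dotZr lerD// ler_wpM2l.
Qed.

Hypothesis qualification :
  [\/ C `&` D° !=set0, D `&` C° !=set0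
    | finite_dimensional H /\ rint C `&` rint D !=set0].

Let interior_step (S : set H) q v : S° q -> exists2 s, 0 < s & S (q + s *: v).
Proof.
move=> /nbhs_ballP[e /= e0 he].
have v0 : 0 < `|v| + 1 by rewrite ltr_wpDl.
exists (e / 2 / (`|v| + 1)); first by rewrite !divr_gt0.
apply: he; rewrite -ball_normE /= opprD addrA subrr add0r normrN normrZ.
rewrite gtr0_norm ?divr_gt0// mulrAC ltr_pdivrMr//.
rewrite -mulrA ltr_pM2l//.
by have := normr_ge0 v; lra.
Qed.

(** The point beyond [q] on the line from [y] through [q] lies in the affine
hull. *)
Let rint_step (S : set H) q y : rint S q -> S y ->
  exists2 s, 0 < s & S (q - s *: (y - q)).
Proof.
move=> [Sq [e e0 he]] Sy.
have v0 : 0 < `|y - q| + 1 by rewrite ltr_wpDl.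
pose s := e / 2 / (`|y - q| + 1).
exists s; first by rewrite !divr_gt0.
apply: he; split.
  rewrite -ball_normE /= opprB addrC subrK normrZ.
  rewrite gtr0_norm ?divr_gt0// mulrAC ltr_pdivrMr//.
  rewrite -mulrA ltr_pM2l//.
  by have := normr_ge0 (y - q); lra.
exists 2%N, (fun i : 'I_2 => if i == ord0 then q else y),
  (fun i : 'I_2 => if i == ord0 then 1 + s else - s).
split; first by move=> i; case: ifP.
  by rewrite !big_ord_recl big_ord0/= addr0 addrK.
rewrite !big_ord_recl big_ord0/= addr0 scalerDl scale1r scaleNr scalerBr.
by rewrite opprB addrA addrAC.
Qed.

(** If [q] is interior to [D] or to [C], then [q - D] or [C - q] absorbs every
direction. In the relative interior case the directions along which the
multipliers are bounded on both sides form a subspace [W], which contains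
[C - q], [D - q] and hence the multipliers themselves; a direction can then be
replaced with its orthogonal projection on [W]. *)
Lemma multipliers_bounded : exists M, forall n, `|u n| <= M.
Proof.
apply: pointwise_bounded_seq => v; rewrite -/(bounded_along v).
case: qualification => [[q [Cq Dq]]|[q [Dq Cq]]|[[d [e espan]] [q [Cq Dq]]]].
- have [s s0 Ds] := interior_step (- v) Dq.
  apply: (bounded_alongZ s0); have := bounded_alongD Cq Ds.
  by rewrite opprD addrA subrr add0r scalerN opprK.
- have [s s0 Cs] := interior_step v Cq.
  apply: (bounded_alongZ s0); have := bounded_alongC (interior_subset Cq) Dq Cs.
  by rewrite addrAC subrr add0r.
pose W : set H := [set v | bounded_along v /\ bounded_along (- v)].
have subW : is_subspace W.
  have W0 : bounded_along 0 by exists 0 => n; rewrite dot0r.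
  split; first by split; rewrite ?oppr0.
  move=> a y w [y1 y2] [w1 w2]; rewrite /W/=.
  have [a0|a0] := leP 0 a.
    split.
      by have := bounded_along_comb a0 ler01 y1 w1; rewrite scale1r.
    have := bounded_along_comb a0 ler01 y2 w2.
    by rewrite scale1r opprD scalerN.
  have {}a0 : 0 <= - a by rewrite oppr_ge0 ltW.
  split.
    have := bounded_along_comb a0 ler01 y2 w1.
    by rewrite scale1r scalerN scaleNr opprK.
  have := bounded_along_comb a0 ler01 y1 w2.
  by rewrite scale1r opprD scaleNr.
have WC y : C y -> W (y - q).
  move=> Cy; split; first exact: bounded_alongC Cq.1 Dq.1 Cy.
  have [s s0 Cs] := rint_step Cq Cy.
  apply: (bounded_alongZ s0); have := bounded_alongC Cq.1 Dq.1 Cs.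
  by rewrite addrAC subrr add0r scalerN.
have WD y : D y -> W (y - q).
  move=> Dy; split; last by rewrite opprB; exact: bounded_alongD Cq.1 Dy.
  have [s s0 Ds] := rint_step Dq Dy.
  apply: (bounded_alongZ s0); have := bounded_alongD Cq.1 Ds.
  by rewrite opprB addrC subrK.
have Wu n : W (u n).
  have [W0 Wcomb] := subW.
  have -> : u n = n.+1%:R *: ((-1) *: (P (x n) - q) + (x n - q)) + 0.
    by rewrite addr0 /u scaleN1r opprB [q - _ + _]addrC addrA subrK.
  apply: (Wcomb) => //; apply: (Wcomb); first exact: WC (P_proj _).1.
  exact: WD.
have [|v' [[M hM] _] ort] := orthogonal_projection dot_norm subW _ v (e := e).
  by move=> w _; exact: espan.
exists M => n; rewrite -(subrK v' v) dotDr ort ?add0r//.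
Qed.

(** Adding the subgradient inequalities at [x n] and [x m], and the normal cone
inequalities at their projections, leaves
[|x n - x m|^2 <= dot (u m - u n) (u n / (n+1) - u m / (m+1))], which is small as
the multipliers are bounded. The limit belongs to [C] and to [D], and minimality
of [p] together with [penalized_bound] identifies it with [p]. *)
Lemma penalized_iterates_cvg : x n @[n --> \oo] --> p.
Proof.
have [M hM] := multipliers_bounded.
have M0 : 0 <= M by exact: le_trans (hM 0%N).
have uE n : x n = P (x n) + n.+1%:R^-1 *: u n.
  by rewrite /u scalerA mulVf// scale1r addrC subrK.
have [n m|l xl] := @sqr_dist_cvg _ _ x (2 * M ^+ 2).
  have := multiplier_subgradient n (Dx m).
  have := multiplier_subgradient m (Dx n).
  have := multiplier_normal n (P_proj (x m)).1.
  have := multiplier_normal m (P_proj (x n)).1.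
  have := dot_le dot_norm (u m - u n) (n.+1%:R^-1 *: u n - m.+1%:R^-1 *: u m).
  have e1 : x m - x n = - (x n - x m) by rewrite opprB.
  have e2 : P (x m) - P (x n) = - (P (x n) - P (x m)) by rewrite opprB.
  have e3 : x n - x m = (P (x n) - P (x m)) +
      (n.+1%:R^-1 *: u n - m.+1%:R^-1 *: u m).
    by rewrite {1}(uE n) {1}(uE m) opprD addrACA.
  have e4 : (x n - p) - (x m - p) = x n - x m by rewrite opprB addrA subrK.
  have : `|u m - u n| * `|n.+1%:R^-1 *: u n - m.+1%:R^-1 *: u m| <=
      2 * M ^+ 2 * (n.+1%:R^-1 + m.+1%:R^-1).
    have -> : 2 * M ^+ 2 * (n.+1%:R^-1 + m.+1%:R^-1) =
       (M + M) * (n.+1%:R^-1 * M + m.+1%:R^-1 * M) :> R by ring.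
    apply: ler_pM => //; rewrite (le_trans (ler_normB _ _))// lerD//.
      by rewrite normrZ ger0_norm ?invr_ge0// ler_wpM2l ?invr_ge0.
    by rewrite normrZ ger0_norm ?invr_ge0// ler_wpM2l ?invr_ge0.
  move=> h1 h2 h3 h4 h5 h6; apply: le_trans h1; apply: le_trans h2.
  rewrite dot_norm -{1}e4; move: h3 h4 h5 h6; rewrite e1 e2 !dotNr.
  rewrite e3; move: (P _ - P _) (n.+1%:R^-1 *: u n - m.+1%:R^-1 *: u m) => y w.
  by rewrite !(dotDl, dotDr, dotNl); lra.
have Cl : C l.
  apply: (closed_cvg _ C_closed (u_ := P \o x) (F := \oo)).
    by apply: nearW => n; exact: (P_proj _).1.
  have -> : P \o x = (fun n => x n - n.+1%:R^-1 *: u n).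
    by apply/funext => n /=; rewrite {2}(uE n) addrK.
  rewrite -[X in _ --> X]subr0; apply: cvgB => //.
  apply/cvgr0Pnorm_le => e e0.
  have := @cvg_harmonic R; move=> /cvgrPdist_le/(_ (e / (M + 1))).
  rewrite divr_gt0 ?ltr_wpDl// => /(_ isT); apply: filterS => n.
  rewrite /harmonic sub0r normrN => h; rewrite normrZ.
  rewrite (le_trans (ler_pM _ _ h (_ : _ <= M + 1)))//.
    by rewrite (le_trans (hM n))// lerDl.
  by rewrite divfK// gt_eqF// ltr_wpDl.
have cb : (phi p - 2^-1 * (`|x n - p| * `|x n - p|)) @[n --> \oo] -->
    phi p - 2^-1 * (`|l - p| * `|l - p|).
  apply: cvgB; first exact: cvg_cst.
  by apply: cvgMr; apply: cvgM; apply: cvg_norm; apply: cvgB => //; exact: cvg_cst.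
have hb n : phi (x n) <= phi p - 2^-1 * (`|x n - p| * `|x n - p|).
  by have := penalized_bound n; rewrite expr2; lra.
have [Dl phil] := lsc_cvg _ phi_lsc Dx hb xl cb.
have := p_min Cl Dl; rewrite -expr2 dot_norm in phil => phipl.
have lp : dot (l - p) (l - p) <= 0 by lra.
by have /eqP := dot_eq0 dot_norm lp; rewrite subr_eq0 => /eqP <-.
Qed.

(** Weak convergence of [u n] and strong convergence of [x n] allow passing to the
limit in [multiplier_normal] and [multiplier_subgradient]. *)
Lemma penalization_multiplier : exists v,
  (forall y, C y -> dot v (y - p) <= 0) /\
  (forall y, D y -> phi p <= phi y + dot v (y - p)).
Proof.
have [M hM] := multipliers_bounded.
have M0 : 0 <= M by exact: le_trans (hM 0%N).
have [U [UU subU]] := ultraFilterLemma eventually_filter.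
have [v hv] := weak_ultralimit dot_norm UU hM.
have xU : x n @[n --> U] --> p.
  by apply: cvg_trans penalized_iterates_cvg => A /subU.
have nU : `|x n - p| @[n --> U] --> (0 : R).
  rewrite -(normr0 H) -(subrr p).
  by apply: cvg_norm; apply: cvgB => //; exact: cvg_cst.
exists v; split => y hy.
  apply: (ler_cvg_to (hv (y - p)) (g := fun n => M * `|x n - p|)).
    by rewrite -[X in _ --> X](mulr0 M); exact: cvgMr.
  apply: nearW => n; have := multiplier_normal n hy.
  have -> : y - P (x n) = (y - p) - (P (x n) - p) by rewrite opprB addrA subrK.
  rewrite dotDr dotNr subr_le0 => /le_trans; apply.
  rewrite (le_trans (dot_le dot_norm _ _))// ler_pM//.
  have Pp : is_proj p p by split => // w Cw; rewrite subrr dot0l subrr.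
  exact: is_prox_nonexp (P_proj _) Pp.
have cb : (phi y + dot (u n) (y - p) + M * `|x n - p| +
     `|x n - p| * (`|y - p| + `|x n - p|)) @[n --> U] --> phi y + dot v (y - p).
  have -> : phi y + dot v (y - p) = phi y + dot v (y - p) + M * 0 + 0 * (`|y - p| + 0).
    by rewrite mulr0 mul0r !addr0.
  apply: cvgD; [apply: cvgD; [apply: cvgD|]|].
  - exact: cvg_cst.
  - exact: hv.
  - exact: cvgMr.
  - by apply: cvgM => //; apply: cvgD => //; exact: cvg_cst.
apply: (lsc_cvg _ phi_lsc Dx _ xU cb).2 => n.
have := multiplier_subgradient n hy.
have -> : y - x n = (y - p) - (x n - p) by rewrite opprB addrA subrK.
have := dot_le dot_norm (u n) (p - x n); rewrite (distrC p) => h1.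
have := dot_le dot_norm (x n - p) ((y - p) - (x n - p)).
have := ler_wpM2l (normr_ge0 (x n - p)) (ler_normB (y - p) (x n - p)).
have := ler_wpM2r (normr_ge0 (x n - p)) (hM n).
move: h1; rewrite -(opprB (x n) p).
move: (x n - p) (y - p) (u n) => b a w.
by rewrite !(dotDl, dotDr, dotNr); lra.
Qed.

End Penalization.
End Multiplier.

(** * The Douglas-Rachford operator and the forward-backward step *)

Section DouglasRachford.
Context (R : realType) (H : completeNormedModType R) (dot : {dot H for idfun}).
Hypothesis dot_norm : hilbert_norm dot.

Lemma exists_multiplier (C D : set H) (phi : H -> R) p :
  closed C -> convex_on C (fun=> 0 : R) -> convex_on D phi -> lsc_on D phi ->
  C p -> D p -> (forall y, C y -> D y -> phi p <= phi y) ->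
  [\/ C `&` D° !=set0, D `&` C° !=set0
    | finite_dimensional H /\ rint C `&` rint D !=set0] ->
  exists v, (forall y, C y -> dot v (y - p) <= 0) /\
            (forall y, D y -> phi p <= phi y + dot v (y - p)).
Proof.
move=> cC vC vphi lphi Cp Dp pmin qual.
have /choice[P hP] w : exists q, is_prox dot C (fun=> 0) w q.
  by apply: is_prox_exists => //; [exists p|exact: lsc_on_cst].
have /choice[x hx] := penalized_prox dot_norm vC vphi lphi Dp hP.
exact: (penalization_multiplier dot_norm cC vC vphi lphi Cp Dp pmin hP hx qual).
Qed.

Definition dr_op (JA JB : H -> H) z := z + (JA (2 *: JB z - z) - JB z).

Section Operator.
Variables (DA DB : set H) (a b : H -> R) (JA JB : H -> H).
Hypothesis JA_prox : forall x, is_prox dot DA a x (JA x).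
Hypothesis JB_prox : forall x, is_prox dot DB b x (JB x).

(** Sum of the monotonicity inequalities of [JB] between [x] and [y], and of [JA]
between the reflected points. *)
Lemma dr_op_firm : firmly_nonexp dot (dr_op JA JB).
Proof.
move=> x y; rewrite /dr_op.
have := is_prox_monotone (JA_prox (2 *: JB x - x)) (JA_prox (2 *: JB y - y)).
have := is_prox_monotone (JB_prox x) (JB_prox y).
move: (JB x) (JB y) => bx by_.
move: (JA (2 *: bx - x)) (JA (2 *: by_ - y)) => ax ay.
have -> : x - bx - (y - by_) = (x - y) - (bx - by_) by vector_eq dot_norm.
have -> : 2 *: bx - x - ax - (2 *: by_ - y - ay) =
    2 *: (bx - by_) - (x - y) - (ax - ay) by vector_eq dot_norm.
have -> : x + (ax - bx) - (y + (ay - by_)) = (x - y) + ((ax - ay) - (bx - by_)).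
  by vector_eq dot_norm.
have -> : x - (x + (ax - bx)) - (y - (y + (ay - by_))) =
    (bx - by_) - (ax - ay) by vector_eq dot_norm.
move: (x - y) (ax - ay) (bx - by_) => d v w.
rewrite !(dotDl, dotDr, dotNl, dotNr, dotZl) ?(dotC dot v w) ?(dotC dot v d) ?(dotC dot w d).
lra.
Qed.

Lemma dr_op_fixed z p : is_prox dot DB b z p -> is_prox dot DA a (2 *: p - z) p ->
  dr_op JA JB z = z.
Proof.
move=> hB hA; rewrite /dr_op (is_prox_uniq dot_norm (JB_prox z) hB).
by rewrite (is_prox_uniq dot_norm (JA_prox _) hA) subrr addr0.
Qed.

Lemma dr_op_fixedE z : dr_op JA JB z = z -> JA (2 *: JB z - z) = JB z.
Proof.
rewrite /dr_op -[RHS]addr0 => /addrI /eqP.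
by rewrite subr_eq0 => /eqP.
Qed.

(** An error on the inner resolvent is amplified at most sixfold: [JA] is
evaluated at twice the perturbed point, and [t < 2]. *)
Lemma dr_op_inexact z y (t : R) : 0 < t < 2 ->
  `|z + t *: (JA (2 *: y - z) - y) - (z + t *: (dr_op JA JB z - z))| <=
  6 * `|y - JB z|.
Proof.
move=> /andP[t0 t2].
have -> : z + t *: (JA (2 *: y - z) - y) - (z + t *: (dr_op JA JB z - z)) =
    t *: ((JA (2 *: y - z) - JA (2 *: JB z - z)) - (y - JB z)).
  by rewrite /dr_op; vector_eq dot_norm.
rewrite normrZ gtr0_norm//.
have h : `|JA (2 *: y - z) - JA (2 *: JB z - z)| <= 2 * `|y - JB z|.
  apply: (le_trans (is_prox_nonexp dot_norm (JA_prox _) (JA_prox _))).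
  have -> : 2 *: y - z - (2 *: JB z - z) = 2 *: (y - JB z).
    by rewrite opprB addrA subrK scalerBr.
  by rewrite normrZ ger0_norm.
have := ler_normB (JA (2 *: y - z) - JA (2 *: JB z - z)) (y - JB z).
have := normr_ge0 (y - JB z).
move: h; move: (JA _ - JA _) (y - JB z) => v w.
move: `|v| `|w| `|v - w| => s r q h r0 h2.
have : t * q <= t * (3 * r) by rewrite ler_wpM2l ?(ltW t0)//; lra.
have : t * (3 * r) <= 2 * (3 * r) by rewrite ler_wpM2r ?(ltW t2)//; lra.
lra.
Qed.

End Operator.

Section ForwardBackward.
Variables (C : set H) (g : H -> R) (dg : H -> H) (beta kappa : R).
Hypothesis beta_gt0 : 0 < beta.
Hypothesis kappa_gt0 : 0 < kappa.
Hypothesis g_convex : convex_on C (fun y => kappa * g y).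
Hypothesis subg : forall x y, g x + dot (dg x) (y - x) <= g y.
Hypothesis lip : forall x y, `|dg x - dg y| <= beta * `|x - y|.

(** The smooth part enters the optimality condition through its gradient, by the
quadratic upper bound of [descent]. *)
Lemma prox_optimality z p y : is_prox dot C (fun y => kappa * g y) z p -> C y ->
  dot (z - p - kappa *: dg p) (y - p) <= 0.
Proof.
move=> hp Cy; have [Cp pmin] := (is_proxP dot_norm _ _ g_convex).1 hp.
have C_convex : convex_on C (fun=> 0 : R).
  move=> v w t Cv Cw t01; split; last by rewrite !mulr0 addr0.
  exact: (g_convex Cv Cw t01).1.
have key := @argmin_variational _ _ C (fun=> 0)
  (fun y => kappa * g y + 2^-1 * `|y - z| ^+ 2)
  (kappa * dot (dg p) (y - p) + dot (p - z) (y - p))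
  ((kappa * (beta / 2) + 2^-1) * `|y - p| ^+ 2) p y C_convex Cp Cy.
have -> : z - p - kappa *: dg p = - (kappa *: dg p + (p - z)).
  by rewrite opprD opprB addrC.
rewrite dotNl (dotDl _ (kappa *: dg p)) dotZl oppr_le0.
rewrite subrr add0r in key; rewrite -[X in _ <= X]add0r; apply: key.
  by move=> w Cw; rewrite add0r; exact: pmin.
move=> t /andP[t0 t1].
have := descent dot_norm beta_gt0 subg lip p (t *: y + (1 - t) *: p).
have -> : t *: y + (1 - t) *: p - p = t *: (y - p).
  by rewrite scalerBl scale1r scalerBr addrCA addrAC subrr add0r.
have -> : t *: y + (1 - t) *: p - z = (p - z) + t *: (y - p).
  by rewrite scalerBl scale1r scalerBr addrCA addrAC.
rewrite normrZ exprMn (gtr0_norm t0) => /(ler_wpM2l (ltW kappa_gt0)).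
rewrite !dot_norm; move: (g _) (p - z) (y - p) => gt u v.
by rewrite !(dotDl, dotDr, dotZl, dotZr) (dotC dot v u); lra.
Qed.

(** The proximal point of [kappa g] on [C] is a fixed point of the
forward-backward step: its residual there is a positive multiple of
[z - p - kappa dg p], which is normal to [C] at [p]. *)
Lemma forward_backward_fixed z p (t : R) : 0 < t ->
  is_prox dot C (fun y => kappa * g y) z p ->
  is_prox dot C (fun=> 0) ((1 + t)^-1 *: (p - t *: (kappa *: dg p - z))) p.
Proof.
move=> t0 hp; split; first by case: hp.
move=> y Cy; rewrite subrr.
have t1 : 0 < 1 + t by rewrite addr_gt0.
have -> : (1 + t)^-1 *: (p - t *: (kappa *: dg p - z)) - p =
    (t / (1 + t)) *: (z - p - kappa *: dg p).
  have -> : t / (1 + t) = (1 + t)^-1 * t by rewrite mulrC.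
  rewrite -scalerA -{3}[p](scalerK (lt0r_neq0 t1)) -scalerBr; congr (_ *: _).
  by vector_eq dot_norm.
rewrite dotZl mulr_ge0_le0 ?divr_ge0 ?(ltW t0) ?(ltW t1)//.
exact: prox_optimality.
Qed.

(** The forward step is nonexpansive and the division by [1 + t] makes the
backward step a contraction of factor [1 / (1 + t)]. *)
Lemma forward_backward_contract z p w w' (t l : R) : 0 < t ->
  t < 2 * kappa^-1 * beta^-1 -> 0 <= l <= 1 ->
  is_prox dot C (fun y => kappa * g y) z p ->
  is_prox dot C (fun=> 0) ((1 + t)^-1 *: (w - t *: (kappa *: dg w - z))) w' ->
  `|w + l *: (w' - w) - p| <= (1 - l * t / (1 + t)) * `|w - p|.
Proof.
move=> t0 t2 /andP[l0 l1] hp hw'.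
have t1 : 0 < 1 + t by rewrite addr_gt0.
have hw : `|w' - p| <= (1 + t)^-1 * `|w - p|.
  apply: (le_trans (is_prox_nonexp dot_norm hw' (forward_backward_fixed t0 hp))).
  rewrite -scalerBr normrZ gtr0_norm ?invr_gt0// ler_wpM2l ?invr_ge0 ?(ltW t1)//.
  have -> : w - t *: (kappa *: dg w - z) - (p - t *: (kappa *: dg p - z)) =
     (w - (t * kappa) *: dg w) - (p - (t * kappa) *: dg p).
    by vector_eq dot_norm.
  apply: (gradient_step_nonexp dot_norm beta_gt0 subg lip).
    by rewrite mulr_ge0 ?ltW.
  rewrite -ler_pdivlMr// -ler_pdivlMr// mulrAC.
  exact: ltW.
have -> : w + l *: (w' - w) - p = (1 - l) *: (w - p) + l *: (w' - p).
  by vector_eq dot_norm.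
rewrite (le_trans (ler_normD _ _))// !normrZ (ger0_norm l0) ger0_norm ?subr_ge0//.
have := ler_wpM2l l0 hw.
have -> : 1 - l * t / (1 + t) = 1 - l + l * (1 + t)^-1.
  by field; rewrite lt0r_neq0.
lra.
Qed.

End ForwardBackward.
End DouglasRachford.

(** * Proximity operators of extended real functions *)

Section ExtendedReal.
Context (R : realType) (H : completeNormedModType R) (dot : {dot H for idfun}).
Hypothesis dot_norm : hilbert_norm dot.

Lemma convex_set_convex_on (C : set H) :
  convex_set (C : set (convex_lmodType H)) -> convex_on C (fun=> 0 : R).
Proof.
move=> cC x y t Cx Cy /andP[t0 t1]; split; last by rewrite !mulr0 addr0.
have := cC x y (Itv01 (ltW t0) (ltW t1)).
by rewrite !inE => /(_ Cx Cy).
Qed.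

(** Bridge from minimization of extended real functions to the variational
inequality: existence makes the choice in [prox] meaningful, and a minimizer
has a finite value. *)
Lemma prox_is_prox (D : set H) (phi : H -> R) (h : H -> \bar R) x :
  D !=set0 -> convex_on D phi -> lsc_on D phi ->
  (forall y, D y -> h y = (phi y)%:E) -> (forall y, ~ D y -> h y = +oo%E) ->
  is_prox dot D phi x (prox h x).
Proof.
move=> D0 cvx lsc hD hN.
have [p hp] := is_prox_exists dot_norm x D0 cvx lsc.
have [Dp pmin] := (is_proxP dot_norm _ _ cvx).1 hp.
pose F y := ((2^-1 * `|y - x| ^+ 2)%:E + h y)%E.
have FD y : D y -> F y = (phi y + 2^-1 * `|y - x| ^+ 2)%:E.
  by move=> Dy; rewrite /F hD// -EFinD addrC.
have [_ qmin] : argmin setT F (prox h x).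
  apply: (@xgetPex _ 0 (argmin setT F)); exists p; split => // y _.
  have [Dy|Dy] := pselect (D y); first by rewrite !FD// lee_fin pmin.
  by rewrite /F (hN y Dy) addey// leey.
apply/is_proxP => //; split.
  apply/not_notP => Nq; have := qmin p I.
  by rewrite (FD p Dp) /F (hN _ Nq) addey// leye_eq.
have Dq : D (prox h x).
  apply/not_notP => Nq; have := qmin p I.
  by rewrite (FD p Dp) /F (hN _ Nq) addey// leye_eq.
by move=> y Dy; have := qmin y I; rewrite !FD// lee_fin.
Qed.

Lemma metric_proj_is_prox (C : set H) x : closed C -> C !=set0 ->
  convex_on C (fun=> 0 : R) -> is_prox dot C (fun=> 0) x (metric_proj C x).
Proof.
move=> cC C0 cvx.
have [p hp] := is_prox_exists dot_norm x C0 cvx (lsc_on_cst cC).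
have [Cp pmin] := (is_proxP dot_norm _ _ cvx).1 hp.
have [Cq qmin] : argmin C (fun y => `|y - x|%:E) (metric_proj C x).
  apply: (@xgetPex _ 0 (argmin C (fun y => `|y - x|%:E))).
  exists p; split => // y Cy; rewrite lee_fin -ler_sqr ?nnegrE//.
  by have := pmin y Cy; lra.
apply/is_proxP => //; split => // y Cy; have := qmin y Cy.
by rewrite lee_fin -ler_sqr ?nnegrE//; lra.
Qed.

Section Gamma0Function.
Variable f : H -> \bar R.
Hypothesis f_Gamma0 : Gamma0 f.

Lemma Gamma0_fineK y : edom f y -> f y = (fine (f y))%:E.
Proof.
have [fNy _ _ _] := f_Gamma0.
by move=> fy; rewrite fineK// fin_numE gt_eqF//= lt_eqF.
Qed.

Lemma Gamma0_convex : convex_on (edom f) (fine \o f).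
Proof.
have [_ _ cvx _] := f_Gamma0 => x y t fx fy t01.
have := cvx x y t t01; rewrite (Gamma0_fineK fx) (Gamma0_fineK fy) -!EFinM -EFinD.
move=> h; have ft : edom f (t *: x + (1 - t) *: y).
  by rewrite /edom/=; apply: le_lt_trans h _; rewrite ltry.
by split => //; rewrite -lee_fin -Gamma0_fineK.
Qed.

Lemma Gamma0_lsc : lsc_on (edom f) (fine \o f).
Proof.
have [fNy _ _ /lower_semicontinuousP lsc] := f_Gamma0 => a.
rewrite (_ : [set _ | _] = ~` [set x | (a%:E < f x)%E]).
  by rewrite closedC; exact: lsc.
apply/seteqP; split => x /=.
  by move=> [fx]; rewrite -lee_fin -Gamma0_fineK// leNgt => /negP.
move=> /negP; rewrite -leNgt => h.
have fx : edom f x by apply: le_lt_trans h _; rewrite ltry.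
by split => //; rewrite -lee_fin -Gamma0_fineK.
Qed.

End Gamma0Function.

Lemma convex_onZ (D : set H) (phi : H -> R) (k : R) : 0 < k ->
  convex_on D phi -> convex_on D (fun y => k * phi y).
Proof.
move=> k0 cvx x y t Dx Dy t01; have [Dt ht] := cvx x y t Dx Dy t01.
split => //; have := ler_wpM2l (ltW k0) ht; lra.
Qed.

Lemma lsc_onZ (D : set H) (phi : H -> R) (k : R) : 0 < k ->
  lsc_on D phi -> lsc_on D (fun y => k * phi y).
Proof.
move=> k0 lsc a; rewrite (_ : [set _ | _] = [set x | D x /\ phi x <= k^-1 * a]).
  exact: lsc.
by apply/seteqP; split => x /= [Dx]; rewrite ler_pdivlMl.
Qed.

Lemma eseries_unbounded (c : nat -> R) : (forall m, 0 <= c m) ->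
  (\sum_(0 <= m <oo) (c m)%:E = +oo)%E ->
  forall B, exists n, B < \sum_(0 <= m < n) c m.
Proof.
move=> c0 cy B; apply/not_existsP => h.
suff : (\sum_(0 <= m <oo) (c m)%:E <= B%:E)%E by rewrite cy leye_eq.
apply: lime_le; first by apply: is_cvg_nneseries => n _ _; rewrite lee_fin.
by apply: nearW => n; rewrite sumEFin lee_fin leNgt; apply/negP/h.
Qed.

End ExtendedReal.

(** * Error control, fixed points and solutions *)

Section Assembly.
Context (R : realType) (H : completeNormedModType R) (dot : {dot H for idfun}).
Hypothesis dot_norm : hilbert_norm dot.

Lemma geometric_decay (y : nat -> H) p (rho : R) N : 0 <= rho ->
  (forall n, (n < N)%N -> `|y n.+1 - p| <= rho * `|y n - p|) ->
  `|y N - p| <= rho ^+ N * `|y 0%N - p|.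
Proof.
move=> rho0; elim: N => [|N IH] h; first by rewrite mul1r.
rewrite (le_trans (h N _))// exprS -mulrA ler_wpM2l//.
by apply: IH => n nN; apply: h; rewrite ltnW.
Qed.

(** The stopping rule is exactly what makes the bound [xi * rho ^ m] on the
inner error inductive: [b m + d m.+1] bounds the initial distance of the next
inner loop to its own limit. *)
Lemma inner_error_decay (b d : nat -> R) (N : nat -> nat) (rho xi : R) :
  0 < rho -> 0 < xi -> (forall m, (0 < N m)%N) -> b 0%N <= xi ->
  (forall m, b m.+1 <= rho ^+ N m.+1 * (b m + d m.+1)) ->
  (forall m, (0 < m)%N ->
     rho ^+ (N m - 1) * (1 + xi^-1 * rho ^ (1 - m%:Z) * d m) <= 1) ->
  forall m, b m <= xi * rho ^+ m.
Proof.
move=> rho0 xi0 N0 b0 brec rule; elim=> [|m IH]; first by rewrite mulr1.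
apply: (le_trans (brec m)); have := rule m.+1 isT.
have -> : 1 - m.+1%:Z = - m%:Z by rewrite -addn1 PoszD opprD addrCA subrr addr0.
rewrite -invr_expz -exprnP -{2}(subnK (N0 m.+1)) exprD expr1 => h.
have rm : 0 < rho ^+ m by rewrite exprn_gt0.
apply: (@le_trans _ _ (xi * rho ^+ m.+1 *
   (rho ^+ (N m.+1 - 1) * (1 + xi^-1 * rho ^- m * d m.+1)))); last first.
  by rewrite -[leRHS]mulr1 ler_wpM2l// mulr_ge0 ?exprn_ge0 ?ltW.
have -> : xi * rho ^+ m.+1 *
   (rho ^+ (N m.+1 - 1) * (1 + xi^-1 * rho ^- m * d m.+1)) =
   rho ^+ (N m.+1 - 1) * rho * (xi * rho ^+ m + d m.+1).
  by rewrite exprS; field; rewrite !lt0r_neq0.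
by rewrite ler_wpM2l ?lerD2r// mulr_ge0 ?exprn_ge0 ?ltW.
Qed.

Section Solutions.
Variables (C : set H) (f : H -> \bar R) (g : H -> R) (dg : H -> H).
Variables (beta kappa : R).
Hypothesis C_closed : closed C.
Hypothesis C_convex : convex_on C (fun=> 0 : R).
Hypothesis f_Gamma0 : Gamma0 f.
Hypothesis beta_gt0 : 0 < beta.
Hypothesis kappa_gt0 : 0 < kappa.
Hypothesis subg : forall x y, g x + dot (dg x) (y - x) <= g y.
Hypothesis lip : forall x y, `|dg x - dg y| <= beta * `|x - y|.

Let fr y := fine (f y).
Let solution p := argmin C (fun y => f y + (g y)%:E)%E p.

(** At a solution, [g] can be linearized: along a segment the gap between [g] and
its linearization is quadratic. *)
Lemma solution_first_order p : solution p -> edom f p ->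
  forall y, C y -> edom f y -> fr p + dot p (dg p) <= fr y + dot y (dg p).
Proof.
move=> [Cp pmin] fp y Cy fy.
have cvx : convex_on (C `&` edom f) fr.
  move=> v w t [Cv fv] [Cw fw] t01; have [ft ht] := Gamma0_convex f_Gamma0 fv fw t01.
  by split => //; split => //; exact: (C_convex Cv Cw t01).1.
have := @argmin_variational _ _ (C `&` edom f) fr g (dot (dg p) (y - p))
  (beta / 2 * `|y - p| ^+ 2) p y cvx (conj Cp fp) (conj Cy fy).
rewrite (dotC dot p) (dotC dot y) dotDr dotNr => key; rewrite -subr_ge0.
have -> : fr y + dot (dg p) y - (fr p + dot (dg p) p) =
   fr y - fr p + (dot (dg p) y - dot (dg p) p) by ring.
apply: key => [w [Cw fw]|t /andP[t0 t1]].
  have := pmin w Cw; rewrite (Gamma0_fineK f_Gamma0 fp) (Gamma0_fineK f_Gamma0 fw).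
  by rewrite -!EFinD lee_fin.
have := descent dot_norm beta_gt0 subg lip p (t *: y + (1 - t) *: p).
have -> : t *: y + (1 - t) *: p - p = t *: (y - p) by vector_eq dot_norm.
rewrite normrZ exprMn (gtr0_norm t0) dotZr dotDr dotNr; lra.
Qed.

(** Every solution [p] is [JB z] for a fixed point [z] of the Douglas-Rachford
operator: the multiplier [v] splits the optimality condition into
[v + dg p] in the subdifferential of [g] plus the indicator of [C], and
[- (v + dg p)] in that of [f]. *)
Lemma solution_dr_fixed p : solution p ->
  [\/ C `&` (edom f)° !=set0, edom f `&` C° !=set0
    | finite_dimensional H /\ rint C `&` rint (edom f) !=set0] ->
  exists z, is_prox dot C (fun y => kappa * g y) z p /\
    is_prox dot (edom f) (fun y => kappa * fr y) (2 *: p - z) p.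
Proof.
move=> sol qual; have [Cp pmin] := sol.
have [q [Cq fq]] : C `&` edom f !=set0.
  case: qual => [[q [Cq fq]]|[q [fq Cq]]|[_ [q [[Cq _] [fq _]]]]];
  by exists q; split => //; exact: interior_subset.
have fp : edom f p.
  apply: le_lt_trans (_ : (f p <= (fr q + g q - g p)%:E)%E) _; last exact: ltry.
  rewrite EFinB leeBrDr//.
  by have := pmin q Cq; rewrite (Gamma0_fineK f_Gamma0 fq) -EFinD.
pose phi y := fr y + dot y (dg p).
have cphi : convex_on (edom f) phi.
  move=> v w t fv fw t01; have [ft ht] := Gamma0_convex f_Gamma0 fv fw t01.
  by split => //; rewrite /phi dotDl !dotZl; move: ht; rewrite /= -!/(fr _); lra.
have lphi : lsc_on (edom f) phi.
  by apply: lsc_onD; [exact: Gamma0_lsc|exact: continuous_dotl].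
have [v [vC vf]] := exists_multiplier dot_norm C_closed C_convex cphi lphi Cp fp
  (solution_first_order sol fp) qual.
exists (p + kappa *: (v + dg p)); split; split => // y hy.
  have := vC y hy; have := subg p y => h1 h2.
  have -> : p + kappa *: (v + dg p) - p = kappa *: (v + dg p).
    by rewrite addrAC subrr add0r.
  rewrite dotZl dotDl -mulrBr ler_pM2l//; lra.
have -> : 2 *: p - (p + kappa *: (v + dg p)) - p = - (kappa *: (v + dg p)).
  by vector_eq dot_norm.
rewrite dotNl dotZl dotDl -mulrBr -mulrN ler_pM2l//.
have := vf y hy; rewrite /phi (dotC dot y) (dotC dot p) (dotDr _ y (- p) (dg p)) dotNr.
lra.
Qed.

(** At a fixed point both resolvents agree, and the sum of the two proximal
inequalities is the minimality of the common value. *)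
Lemma dr_fixed_solution z p : is_prox dot C (fun y => kappa * g y) z p ->
  is_prox dot (edom f) (fun y => kappa * fr y) (2 *: p - z) p -> solution p.
Proof.
move=> [Cp hg] [fp hf]; split => // y Cy.
have [fNy _ _ _] := f_Gamma0.
have [fy|] := pselect (edom f y); last first.
  move=> /negP; rewrite -leNgt leye_eq => /eqP ->.
  by rewrite addye// leey.
rewrite (Gamma0_fineK f_Gamma0 fp) (Gamma0_fineK f_Gamma0 fy) -!EFinD lee_fin.
have := hg y Cy; have := hf y fy.
have -> : 2 *: p - z - p = - (z - p) by vector_eq dot_norm.
rewrite dotNl -/(fr y) -/(fr p) => h1 h2; rewrite -(ler_pM2l kappa_gt0); lra.
Qed.

End Solutions.
End Assembly.

(** * The nested algorithm *)

(* [zh m] is the half-step iterate z_{m - 1/2}; thus z_{m + 1/2} is [zh m.+1].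
   [x m n], [gamma m n], [lambda m n] are only constrained for the indices
   that the algorithm uses. *)
Theorem proposition4p1
  (R : realType) (H : completeNormedModType R) (dot : {dot H for idfun})
  (dot_norm : hilbert_norm dot)
  (H_separable : separable_space H)
  (C : set H) (C_neq0 : C !=set0) (C_closed : closed C)
  (C_convex : convex_set (C : set (convex_lmodType H)))
  (f : H -> \bar R) (f_Gamma0 : Gamma0 f)
  (g : H -> R) (g_Gamma0 : Gamma0 (EFin \o g))
  (g_diff : forall y : H, differentiable g y)
  (beta : R) (beta_gt0 : 0 < beta)
  (gradg_lip : beta.-lipschitz (gradient dot g))
  (solvable : argmin C (fun y => f y + (g y)%:E)%E !=set0)
  (qualification :
     [\/ C `&` (edom f)° !=set0,
         edom f `&` C° !=set0
       | finite_dimensional H /\ rint C `&` rint (edom f) !=set0])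
  (kappa : R) (kappa_gt0 : 0 < kappa)
  (gamma_inf : R) (gamma_inf_itv : 0 < gamma_inf < 2 * kappa^-1 * beta^-1)
  (lambda_inf : R) (lambda_inf_itv : 0 < lambda_inf <= 1)
  (tau : nat -> R) (tau_itv : forall m, 0 < tau m < 2)
  (tau_sum : (\sum_(0 <= m <oo) (tau m * (2 - tau m))%:E = +oo)%E)
  (N : nat -> nat) (N_gt0 : forall m, (0 < N m)%N)
  (gamma lambda : nat -> nat -> R)
  (gamma_itv : forall m n, (n < N m)%N ->
     gamma_inf <= gamma m n < 2 * kappa^-1 * beta^-1)
  (lambda_itv : forall m n, (n < N m)%N -> lambda_inf <= lambda m n <= 1)
  (z zh : nat -> H) (x : nat -> nat -> H)
  (init_C : C (z 0%N)) (init_half : zh 0%N = z 0%N)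
  (inner_init : forall m, x m 0%N = zh m)
  (inner_step : forall m n, (n < N m)%N ->
     x m n.+1 = x m n + lambda m n *:
       (metric_proj C ((1 + gamma m n)^-1 *:
          (x m n - gamma m n *: (kappa *: gradient dot g (x m n) - z m)))
        - x m n))
  (half_step : forall m, zh m.+1 = x m (N m))
  (outer_step : forall m,
     z m.+1 = z m + tau m *:
       (prox (fun y => kappa%:E * f y)%E (2 *: zh m.+1 - z m) - zh m.+1)) :
  (forall xi rho : R, 0 < xi ->
     rho = 1 - lambda_inf * gamma_inf / (1 + gamma_inf) ->
     let inf_gC := ereal_inf [set (g y)%:E | y in C] in
     (-oo < inf_gC)%E ->
     rho ^+ N 0%N * Num.sqrt (2 * kappa) * Num.sqrt (g (z 0%N) - fine inf_gC)
       <= xi ->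
     (forall m, (0 < m)%N ->
        rho ^+ (N m - 1) *
          (1 + xi^-1 * rho ^ (1 - m%:Z) * `|z m - z m.-1|) <= 1) ->
     exists zlim : H,
       weakly_cvg_to dot z zlim /\
       argmin C (fun y => f y + (g y)%:E)%E
         (prox (fun y => eindicator R C y + (kappa * g y)%:E)%E zlim))
  /\
  (forall m, (forall n, (n <= N m)%N -> C (x m n)) /\ C (zh m.+1)).
Proof.
move: lambda_inf_itv gamma_inf_itv => /andP[li0 li1] /andP[gi0 gi2].
have Ccvx := convex_set_convex_on C_convex.
have gT : edom (EFin \o g) = setT by apply/seteqP; split => // y _; exact: ltry.
have gcvx : convex_on setT g by have := Gamma0_convex g_Gamma0; rewrite gT.
have subg y w : g y + dot (gradient dot g y) (w - y) <= g w.
  exact: gradient_le.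
have lip y w : `|gradient dot g y - gradient dot g w| <= beta * `|y - w|.
  exact: (gradg_lip (y, w) (conj I I)).
have JCprox y : is_prox dot C (fun=> 0) y (metric_proj C y).
  exact: metric_proj_is_prox.
pose JA := prox (fun y => kappa%:E * f y)%E.
pose JB := prox (fun y => eindicator R C y + (kappa * g y)%:E)%E.
have kgcvx : convex_on C (fun y => kappa * g y).
  move=> y w t Cy Cw t01; split; first exact: (Ccvx y w t Cy Cw t01).1.
  exact: (convex_onZ kappa_gt0 gcvx I I t01).2.
have JAprox y : is_prox dot (edom f) (fun y => kappa * fine (f y)) y (JA y).
  have [fNy f0 _ _] := f_Gamma0.
  apply: prox_is_prox => //.
  - exact: convex_onZ (Gamma0_convex f_Gamma0).
  - exact: lsc_onZ (Gamma0_lsc f_Gamma0).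
  - by move=> w fw; rewrite EFinM -Gamma0_fineK.
  - move=> w /negP; rewrite -leNgt leye_eq => /eqP ->.
    by rewrite gt0_muley// lte_fin.
have JBprox y : is_prox dot C (fun y => kappa * g y) y (JB y).
  apply: prox_is_prox => //.
  - apply: lsc_on_continuous => // w; apply: cvgMr.
    exact: differentiable_continuous.
  - by move=> w Cw; rewrite /eindicator mem_set// add0e.
  - by move=> w Cw; rewrite /eindicator memNset.
(* t / (1 + t) increases with t *)
have rho_le m n : (n < N m)%N ->
    1 - lambda m n * gamma m n / (1 + gamma m n) <=
    1 - lambda_inf * gamma_inf / (1 + gamma_inf).
  move=> nN; have /andP[l1 _] := lambda_itv m n nN.
  have /andP[g1 _] := gamma_itv m n nN.
  have gi1 : 0 < 1 + gamma_inf by rewrite addr_gt0.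
  have g0 : 0 < gamma m n by exact: lt_le_trans g1.
  have g11 : 0 < 1 + gamma m n by rewrite addr_gt0.
  rewrite lerD2l lerN2 -!mulrA; apply: ler_pM => //; first exact: ltW.
    by rewrite divr_ge0 ?ltW.
  by rewrite ler_pdivrMr// mulrAC ler_pdivlMr//; lra.
have inC m : (forall n, (n <= N m)%N -> C (x m n)) /\ C (zh m.+1).
  have loop k : C (zh k) -> forall n, (n <= N k)%N -> C (x k n).
    move=> Ck; elim=> [|n IH] nN; first by rewrite inner_init.
    rewrite inner_step//; set w := metric_proj C _.
    have /andP[l0 l1] := lambda_itv k n nN.
    have Cw : C w by case: (JCprox ((1 + gamma k n)^-1 *:
          (x k n - gamma k n *: (kappa *: gradient dot g (x k n) - z k)))).
    have [->|l_neq1] := eqVneq (lambda k n) 1.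
      by rewrite scale1r addrC subrK.
    have -> : x k n + lambda k n *: (w - x k n) =
        lambda k n *: w + (1 - lambda k n) *: x k n by vector_eq dot_norm.
    apply: (Ccvx w (x k n) (lambda k n) Cw (IH (ltnW nN)) _).1.
    by rewrite (lt_le_trans li0)// lt_neqAle l_neq1.
  suff Czh k : C (zh k) by split; [exact: loop|exact: Czh].
  elim: k => [|k IH]; first by rewrite init_half.
  by rewrite half_step; apply: loop.
split=> // xi rho xi0 rhoE inf_gC inf_gt stop0 stop.
have gi1 : 0 < 1 + gamma_inf by rewrite addr_gt0.
have rho1 : rho < 1.
  by rewrite rhoE gtrBl divr_gt0// mulr_gt0.
have rho0 : 0 < rho.
  rewrite rhoE subr_gt0 ltr_pdivrMr// mul1r.
  by rewrite (@le_lt_trans _ _ gamma_inf)// ?ltrDr// ler_piMl// ltW.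
pose b m := `|zh m.+1 - JB (z m)|.
have b_rec m : b m <= rho ^+ N m * `|zh m - JB (z m)|.
  rewrite /b half_step -inner_init; apply: geometric_decay; first exact: ltW.
  move=> n nN; rewrite inner_step//.
  have /andP[l1 l2] := lambda_itv m n nN; have /andP[g1 g2] := gamma_itv m n nN.
  have g0 : 0 < gamma m n by exact: lt_le_trans g1.
  have l01 : 0 <= lambda m n <= 1 by rewrite l2 andbT (le_trans (ltW li0)).
  have := forward_backward_contract dot_norm beta_gt0 kappa_gt0 kgcvx
    subg lip g0 g2 l01 (JBprox (z m)) (JCprox _).
  by move=> /(_ (x m n))/le_trans; apply; rewrite rhoE ler_wpM2r ?rho_le.
(* the proximal inequality at [z 0], which lies in [C], gives
   |z 0 - JB (z 0)|^2 <= kappa (g (z 0) - g (JB (z 0))) *)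
have b0 : b 0%N <= xi.
  apply: le_trans stop0; apply: (le_trans (b_rec 0%N)).
  rewrite -mulrA ler_wpM2l ?exprn_ge0 ?(ltW rho0)// init_half.
  rewrite -sqrtrM ?mulr_ge0 ?(ltW kappa_gt0)//.
  rewrite -ler_sqr ?nnegrE ?sqrtr_ge0// dot_norm.
  have [CJ hJ] := JBprox (z 0%N); have := hJ _ init_C.
  have inf_le y : C y -> fine inf_gC <= g y.
    move=> Cy; have le_g : (inf_gC <= (g y)%:E)%E by apply: ereal_inf_lbound; exists y.
    rewrite -lee_fin fineK// fin_numE gt_eqF//=.
    by rewrite lt_eqF// (le_lt_trans le_g)// ltry.
  have i1 := inf_le _ CJ; have i2 := inf_le _ init_C.
  rewrite sqr_sqrtr; last by rewrite mulr_ge0 ?mulr_ge0 ?(ltW kappa_gt0)// subr_ge0.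
  move=> h; apply: (le_trans h); rewrite -mulrBr -mulrA mulrCA ler_pM2l//; lra.
have bE := inner_error_decay rho0 xi0 N_gt0 b0 (d := fun m => `|z m - z m.-1|) _ stop.
have {}bE m : b m <= xi * rho ^+ m.
  apply: bE => k; apply: (le_trans (b_rec k.+1)); rewrite ler_wpM2l ?exprn_ge0 ?(ltW rho0)//=.
  rewrite (le_trans (ler_distD (JB (z k)) _ _))// lerD2l distrC.
  exact: is_prox_nonexp (JBprox _) (JBprox _).
have [p sol] := solvable.
have [w [wB wA]] := solution_dr_fixed dot_norm C_closed Ccvx f_Gamma0 beta_gt0
  kappa_gt0 subg lip sol qualification.
(* tail of the geometric series bounding the errors of the outer steps *)
pose s m := 6 * xi * rho ^+ m / (1 - rho).
have firm := dr_op_firm dot_norm JAprox JBprox.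
have [|m|m||l [Tl zl]] := inexact_iteration_weak_cvg dot_norm firm
    (dr_op_fixed dot_norm JAprox JBprox wB wA) (z := z) tau_itv _ (s := s).
- apply: eseries_unbounded => // m; have /andP[? ?] := tau_itv m.
  by rewrite mulr_ge0; lra.
- rewrite outer_step.
  have h := dr_op_inexact dot_norm JB JAprox (z m) (zh m.+1) (tau_itv m).
  apply: le_trans h _.
  have -> : s m - s m.+1 = 6 * (xi * rho ^+ m).
    by rewrite /s exprS; field; rewrite subr_eq0 eq_sym lt_eqF.
  by rewrite ler_wpM2l//; exact: bE.
- by rewrite /s !mulr_ge0 ?invr_ge0 ?exprn_ge0 ?subr_ge0 ?ltW.
- rewrite /s [X in _ --> X](_ : 0 = 6 * xi * 0 / (1 - rho)); last first.
    by rewrite mulr0 mul0r.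
  apply: cvgMl; apply: cvgMr; apply: cvg_expr.
  by rewrite gtr0_norm.
exists l; split => //; apply: (dr_fixed_solution dot_norm f_Gamma0 kappa_gt0 (JBprox l)).
by have := JAprox (2 *: JB l - l); rewrite (dr_op_fixedE Tl).
Qed.
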